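(* Let $k\geq 3$ be an odd integer. Let $\mu=\sum_{\lambda\in\Lambda}a(\lambda)\delta_\lambda$ be a measure on $\mathbb{R}^k$ whose support $\Lambda$ is a locally finite set. Suppose that $\mu$ is a temperate distribution, and that its Fourier transform $\widehat{\mu}=\sum_{s\in S}b(s)\delta_s$ is also a measure, supported on a locally finite set $S\subset\mathbb{R}^k$. Assume that $0\notin\Lambda$ and $0\notin S$, and let $\sigma$ be the measure on $\mathbb{R}$ defined by $$\sigma=\sum_{\lambda\in\Lambda}\frac{a(\lambda)}{|\lambda|}\big(\delta_{|\lambda|}-\delta_{-|\lambda|}\big).$$ Then $\sigma$ is a temperate distribution whose one-dimensional Fourier transform is $$\widehat{\sigma}=-i\sum_{s\in S}\frac{b(s)}{|s|^{k-2}}\Big[\sum_{j=0}^{(k-3)/2}\beta_{j,k}\,|s|^j\Big((-1)^j\,\delta^{(j)}_{|s|}-\delta^{(j)}_{-|s|}\Big)\Big],$$ where $$\beta_{j,k}=\frac{(-1)^j\,(k-j-3)!}{j!\,(k-2j-3)!!}\Big(\frac{1}{2\pi}\Big)^{(k-3)/2}\quad (0\leq j\leq (k-3)/2).$$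
   Context: A set is locally finite if it has no finite accumulation points. The coefficients $a(\lambda),b(s)$ are complex, $|\cdot|$ is the Euclidean norm, and $\delta_x$ is the unit mass at $x$; $\delta_x^{(j)}$ is its $j$-th distributional derivative, $\langle\delta_x^{(j)},\varphi\rangle=(-1)^j\varphi^{(j)}(x)$. A temperate distribution is a distribution (continuous linear functional on the space of infinitely smooth compactly supported functions) that extends to a continuous linear functional on the Schwartz space. Infinite sums of distributions supported on a locally finite set are understood via their action on compactly supported smooth test functions. The Fourier transform of a Schwartz function on $\mathbb{R}^k$ is $\widehat{\varphi}(\xi)=\int_{\mathbb{R}^k}\varphi(x)e^{-2\pi i\langle\xi,x\rangle}\,dx$, and that of a temperate distribution is defined by $\langle\widehat{\sigma},\varphi\rangle=\langle\sigma,\widehat{\varphi}\rangle$ (bilinear pairing, no conjugation). The double factorial is $n!!=n(n-2)(n-4)\cdots$ (ending in $1$ or $2$), with $0!!=1$. *)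

(* Defs.v *)
From HB Require Import structures.
From mathcomp Require Import all_boot all_order all_algebra.
From mathcomp Require Import all_classical all_reals all_analysis.
From mathcomp Require Import complex.

Set Implicit Arguments.
Unset Strict Implicit.
Unset Printing Implicit Defensive.

Import Order.TTheory GRing.Theory Num.Theory.
Import numFieldNormedType.Exports.

Local Open Scope classical_set_scope.
Local Open Scope ring_scope.
Local Open Scope complex_scope.

Definition cons_pair (T : Type) (n : nat) (p : T * n.-tuple T) : n.+1.-tuple T :=
  [tuple of p.1 :: p.2].

Lemma measurable_cons_pair (d : measure_display) (T : measurableType d)
    (n : nat) : measurable_fun [set: T * n.-tuple T] (@cons_pair T n).
Proof. by apply: measurable_cons; [exact: measurable_fst|exact: measurable_snd]. Qed.

Section tuple_measure_step.
Local Open Scope ereal_scope.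
Context (d : measure_display) (T : measurableType d) (R : realType) (n : nat).
Variables (m : {sigma_finite_measure set T -> \bar R})
  (mu : {sigma_finite_measure set (n.-tuple T) -> \bar R}).

Definition cons_measure : set (n.+1.-tuple T) -> \bar R :=
  pushforward (m \x mu) (@cons_pair T n).

Let mcons (A : set (n.+1.-tuple T)) : measurable A ->
  measurable (@cons_pair T n @^-1` A).
Proof.
by move=> mA; rewrite -[X in measurable X]setTI; exact: measurable_cons_pair.
Qed.

Let cons_measure0 : cons_measure set0 = 0.
Proof. by rewrite /cons_measure /pushforward preimage_set0 measure0. Qed.

Let cons_measure_ge0 A : 0 <= cons_measure A.
Proof. exact: (measure_ge0 (m \x mu)%E). Qed.

Let cons_measure_sigma_additive : semi_sigma_additive cons_measure.
Proof.
move=> F mF tF mUF; rewrite /cons_measure /pushforward preimage_bigcup.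
apply: measure_semi_sigma_additive.
- by move=> i; exact: mcons.
- apply/trivIsetP => /= i j _ _ ij; rewrite -preimage_setI.
  by move/trivIsetP : tF => /(_ _ _ _ _ ij) ->//; rewrite preimage_set0.
- by rewrite -preimage_bigcup; exact: mcons.
Qed.

HB.instance Definition _ := isMeasure.Build _ _ _ cons_measure
  cons_measure0 cons_measure_ge0 cons_measure_sigma_additive.

Let cons_measure_sigma_finite : sigma_finite setT cons_measure.
Proof.
have /sigma_finiteP[F [FT ndF Fm]] := sigma_finiteT m.
have /sigma_finiteP[G [GT ndG Gm]] := sigma_finiteT mu.
pose uncons (t : n.+1.-tuple T) := (thead t, [tuple of behead t]).
have muncons : measurable_fun setT uncons.
  apply/measurable_fun_pairP; split; last exact: measurable_behead.
  exact: measurable_tnth.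
have mFG i : measurable (F i `*` G i).
  by apply: measurableX; [have [] := Fm i|have [] := Gm i].
exists (fun i => uncons @^-1` (F i `*` G i)).
  apply/esym; rewrite -subTset => t _.
  have [i _ Fi] : (\bigcup_i F i) (thead t) by rewrite -FT.
  have [j _ Gj] : (\bigcup_i G i) [tuple of behead t] by rewrite -GT.
  exists (maxn i j) => //; split => /=.
  - by move: Fi; exact/subsetPset/ndF/leq_maxl.
  - by move: Gj; exact/subsetPset/ndG/leq_maxr.
move=> i; split; first by rewrite -[X in measurable X]setTI; exact: muncons.
rewrite /cons_measure /pushforward (_ : _ @^-1` _ = F i `*` G i); last first.
  have consK p : uncons (cons_pair p) = p.
    by case: p => x t; apply: congr2; [|exact/val_inj].
  by apply/funext => p; exact: (congr1 (F i `*` G i) (consK p)).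
have [mF Foo] := Fm i; have [mG Goo] := Gm i.
by rewrite product_measure1E// lte_mul_pinfty// ge0_fin_numE.
Qed.

HB.instance Definition _ := Measure_isSigmaFinite.Build _ _ _ cons_measure
  cons_measure_sigma_finite.

End tuple_measure_step.

(* The [n]-fold product measure of [m]. *)
Fixpoint tuple_measure (d : measure_display) (T : measurableType d)
    (R : realType) (m : {sigma_finite_measure set T -> \bar R}) (n : nat) :
    {sigma_finite_measure set (n.-tuple T) -> \bar R} :=
  if n is n'.+1 then cons_measure m (tuple_measure m n') else \d_[tuple].

(* The product sigma-algebra of [n.-tuple] makes this the Lebesgue measure of
   R^n; points of R^n are elsewhere row vectors. *)
Definition lebesgue_tuple (R : realType) (n : nat) :
    {sigma_finite_measure set (n.-tuple (measurableTypeR R)) -> \bar R} :=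
  tuple_measure (@lebesgue_measure R) n.

Definition dotp (R : realType) (n : nat) (x y : 'rV[R]_n) : R :=
  \sum_(i < n) x 0 i * y 0 i.

(* The norm [`|x|] of the library on ['rV[R]_n] is the sup norm. *)
Definition enorm (R : realType) (n : nat) (x : 'rV[R]_n) : R :=
  Num.sqrt (dotp x x).

Definition locally_finite_set (T : topologicalType) (A : set T) : Prop :=
  limit_point A = set0.

Section distributions.
Context (R : realType) (V : normedModType R).
Implicit Types (f g phi : V -> R[i]) (v : V) (vs : seq V).
Implicit Types (u w T : (V -> R[i]) -> R[i]).

(* The library has no normed [R]-module structure on [R[i]]: topological notions
   for complex-valued functions are taken on real and imaginary parts. *)

Definition cderivable f : Prop := forall x v,
  derivable (fun y => complex.Re (f y)) x v /\ derivable (fun y => complex.Im (f y)) x v.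

Definition ccontinuous f : Prop :=
  continuous (fun y => complex.Re (f y)) /\ continuous (fun y => complex.Im (f y)).

Definition cderive v f : V -> R[i] := fun x =>
  ('D_v (fun y => complex.Re (f y)) x) +i* ('D_v (fun y => complex.Im (f y)) x).

Definition cderives vs f : V -> R[i] := foldr cderive f vs.

(* Directional derivatives of all orders exist and are continuous. When [V] is
   finite-dimensional this is the class C^oo; directional derivatives (rather
   than partial ones) make the definition common to [R] and ['rV[R]_n]. *)
Definition smooth f : Prop := forall vs,
  ccontinuous (cderives vs f) /\ cderivable (cderives vs f).

Definition fsupport f : set V := closure [set x | f x != 0].

Definition test_function f : Prop := smooth f /\ compact (fsupport f).

Definition weighted (N : nat) vs f (x : V) : R :=
  (1 + `|x|) ^+ N * Normc.normc (cderives vs f x).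

Definition schwartz f : Prop := smooth f /\
  forall N vs, exists M : R, forall x, weighted N vs f x <= M.

Definition schwartz_seminorm (p : nat * seq V) f : R :=
  sup (range (weighted p.1 p.2 f)).

(* A functional on a class of functions is represented by a total map on all
   functions [V -> R[i]]; its values outside of the class are irrelevant. *)
Definition linear_on (P : (V -> R[i]) -> Prop) u : Prop :=
  forall (c : R[i]) f g, P f -> P g ->
    u (fun x => c * f x + g x) = c * u f + u g.

Definition eq_distribution u w : Prop :=
  forall phi, test_function phi -> u phi = w phi.

(* Continuity for the LF topology of the test functions. *)
Definition distribution u : Prop := linear_on test_function u /\
  forall K : set V, compact K ->
  exists (C : R) (s : seq (seq V)), forall phi, test_function phi ->
    fsupport phi `<=` K ->
    Normc.normc (u phi) <= C * \sum_(vs <- s) schwartz_seminorm (0, vs) phi.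

Definition schwartz_continuous_linear T : Prop := linear_on schwartz T /\
  exists (C : R) (s : seq (nat * seq V)), forall phi, schwartz phi ->
    Normc.normc (T phi) <= C * \sum_(p <- s) schwartz_seminorm p phi.

Definition schwartz_extension u T : Prop :=
  schwartz_continuous_linear T /\ eq_distribution T u.

Definition temperate u : Prop :=
  distribution u /\ exists T, schwartz_extension u T.

(* [F] is the Fourier transform of Schwartz functions on [V]. The extension [T]
   is unique, because test functions are dense in the Schwartz space. *)
Definition has_fourier_transform (F : (V -> R[i]) -> (V -> R[i])) u w : Prop :=
  exists2 T, schwartz_extension u T & eq_distribution (fun phi => T (F phi)) w.

(* [x] is outside of the support when [u] vanishes near [x]. *)
Definition dsupport u : set V := [set x | forall U, nbhs x U ->
  exists phi, [/\ test_function phi, fsupport phi `<=` U & u phi != 0]].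

Definition delta (x : V) : (V -> R[i]) -> R[i] := fun phi => phi x.

(* The sum is finitely supported when [phi] is compactly supported and [A] is
   locally finite. *)
Definition atomic (A : set V) (a : V -> R[i]) : (V -> R[i]) -> R[i] :=
  fun phi => \sum_(x \in A) a x * delta x phi.

End distributions.

Definition ddelta (R : realType) (j : nat) (x : R) (phi : R -> R[i]) : R[i] :=
  (-1) ^+ j * ((derive1n j (fun y => complex.Re (phi y)) x)
               +i* (derive1n j (fun y => complex.Im (phi y)) x)).

Definition cintegral (d : measure_display) (T : measurableType d) (R : realType)
    (mu : {measure set T -> \bar R}) (f : T -> R[i]) : R[i] :=
  (Rintegral mu setT (fun x => complex.Re (f x)))
  +i* (Rintegral mu setT (fun x => complex.Im (f x))).

Definition expi (R : realType) (t : R) : R[i] := cos t +i* sin t.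

Definition fourier (R : realType) (n : nat) (phi : 'rV[R]_n -> R[i]) :
    'rV[R]_n -> R[i] := fun xi =>
  cintegral (lebesgue_tuple R n) (fun t =>
    let x := \row_(i < n) tnth t i in phi x * expi (- (2 * pi * dotp xi x))).

Definition fourier1 (R : realType) (phi : R -> R[i]) : R -> R[i] := fun xi =>
  cintegral (@lebesgue_measure R) (fun x : R =>
    phi x * expi (- (2 * pi * (xi * x)))).

Fixpoint double_fact (n : nat) : nat :=
  if n is (m.+1 as m').+1 then (m'.+1 * double_fact m)%N else 1%N.

(* The truncated subtractions are exact for [3 <= k] and [j <= (k - 3)./2]. *)
Definition beta_coef (R : realType) (j k : nat) : R :=
  (-1) ^+ j * ((k - j - 3)`!)%N%:R
    / (j`! * double_fact (k - 2 * j - 3))%N%:R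
  * (1 / (2 * pi)) ^+ ((k - 3)./2)%N.

(* Main.v *)
Require Import Defs.
From HB Require Import structures.
From mathcomp Require Import all_boot all_order all_algebra.
From mathcomp Require Import all_classical all_reals all_analysis.
From mathcomp Require Import measurable_realfun complex zify ring lra.
(** Write [k = 2m + 3].  The functional [sigma] is the pullback of [mu] by the map
    sending a function [f] of the line to the radial function
    [(f(|x|) - f(-|x|)) / |x|] of R^k ([radial_quotient]).  The quotient
    [(f(r) - f(-r)) / r] is a smooth even function of [r], and a smooth even
    function of [|x|] is smooth; with the estimates that accompany these two
    facts, the map is continuous between the Schwartz spaces
    ([radial_pullback_continuous]).  Hence [sigma] is tempered, and its Fourier
    transform sends [f] to the value of [mu] at the radial quotient of the
    Fourier transform of [f].

    It remains to exhibit that radial quotient as the Fourier transform on R^k of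
    an explicit test function [Psi]: the value is then the sum of the numbers
    [b(s) Psi(s)].  The tool is the operator [D = (1/r) d/dr] on even functions
    ([rderive]).  In polar coordinates of the plane the fundamental theorem of
    calculus gives
      [int (D e)(sqrt(s^2 + |y|^2)) dy = - 2 pi e(s)]
    ([integral_plane_rderive]), so that integrating out [2n] of the [2n + 1]
    coordinates of the radial function with profile [D^n e] leaves
    [(- 2 pi)^n e] in the last coordinate ([integral_iter_rderive]).  A rotation
    moves any frequency to the first axis ([rotation_to_first_axis]); therefore
    the Fourier transform of this radial function is radial, and its profile is
    [(- 2 pi)^n] times the cosine transform of [e] on the line
    ([integral_radial_wave]).

    Let [o] be twice the odd part of [- i f].  Twice the odd part of the
    Fourier transform of [f] is the sine transform of [o], and an integration by
    parts turns the latter into [- 2 pi r] times the cosine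
    transform of an even primitive [E] of [o].  As [D E = o / r], the case
    [n = m + 1] shows that
      [Psi = (- 2 pi)^(-m) D^m (o / r)], taken at [r = |x|],
    has the required transform ([radial_quotient_fourier1]).  Finally
      [r^(2m+1) D^m (o / r) = sum_j c_(m,j) r^j o^(j)(r)],
    where the [c_(m,j)] are, up to sign, the coefficients of the reverse Bessel
    polynomials ([iter_rderive_quotE]); dividing by [|s|^(k-2)], which is not
    zero because [0] is not in [S], gives the coefficients [beta_(j,k)]. *)

Set Implicit Arguments.
Unset Strict Implicit.
Unset Printing Implicit Defensive.
Import Order.TTheory GRing.Theory Num.Theory.
Import numFieldNormedType.Exports.
Local Open Scope classical_set_scope.
Local Open Scope ring_scope.

(** * Smooth functions of one variable and division by the coordinate *)
Section SmoothFunctionsOnTheLine.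
Variable R : realType.
Implicit Types (f g o e : R -> R) (r s A B K : R).

Definition smooth1 f : Prop := forall n r, derivable (derive1n n f) r 1.

Lemma smooth1_is_derive f n r : smooth1 f ->
  is_derive r 1 (derive1n n f) (derive1n (n.+1) f r).
Proof.
move=> sf; apply: (DeriveDef (sf n r)).
by rewrite derive1nS derive1E.
Qed.

Lemma is_derive_ext (V W : normedModType R) (f g : V -> W) x v d d' :
  f =1 g -> is_derive x v f d -> d = d' -> is_derive x v g d'.
Proof. by move=> /funext -> h <-. Qed.

Lemma derive1nP f (F : nat -> R -> R) : F 0%N = f ->
  (forall n r, is_derive r 1 (F n) (F n.+1 r)) ->
  smooth1 f /\ forall n, derive1n n f = F n.
Proof.
move=> F0 dF; have E n : derive1n n f = F n.
  elim: n => [|n IH]; first by rewrite derive1n0 F0.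
  rewrite derive1nS IH; apply/funext => r.
  by rewrite derive1E; exact: derive_val.
by split => // n r; rewrite E; exact: ex_derive.
Qed.

Lemma smooth1_continuous f n : smooth1 f -> continuous (derive1n n f).
Proof.
by move=> sf r; apply/differentiable_continuous/derivable1_diffP.
Qed.

Lemma smooth1_derive1 f : smooth1 f -> smooth1 (derive1 f).
Proof. by move=> sf n r; rewrite -derive1Sn; exact: sf. Qed.

Lemma smooth1_prim f g : (forall r, is_derive r 1 g (f r)) -> smooth1 f ->
  smooth1 g.
Proof.
move=> dg sf.
apply: (proj1 (@derive1nP g (fun n => if n is m.+1 then derive1n m f else g)
  erefl _)).
by case=> [|n] r; [exact: dg|exact: smooth1_is_derive].
Qed.

(** The measure sigma sees a test function only through this difference. *)
Definition oddp f r := f r - f (- r).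

Lemma is_derive1_oppr f r d : is_derive (- r) 1 f d ->
  is_derive r 1 (fun x => f (- x)) (- d).
Proof.
move=> fd; have := @is_derive1_comp R f -%R r d (-1) fd _.
by rewrite mulrN1; apply; exact: is_deriveNid.
Qed.

Lemma derive1n_oddp f : smooth1 f -> smooth1 (oddp f) /\
  forall n, derive1n n (oddp f) = fun r => derive1n n f r - (-1) ^+ n * derive1n n f (- r).
Proof.
move=> sf; apply: derive1nP => [|n r].
  by apply/funext => r; rewrite expr0 mul1r.
have h1 := smooth1_is_derive n r sf.
have h2 := is_derive1_oppr (smooth1_is_derive n (- r) sf).
apply: (is_derive_ext _ (is_deriveB h1 (is_deriveZ ((-1) ^+ n) h2))) => //.
by rewrite exprSr scalerN /= mulrN1 mulNr.
Qed.

Lemma oddpN f r : oddp f (- r) = - oddp f r.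
Proof. by rewrite /oddp opprK opprB. Qed.

Lemma oddp0 f : oddp f 0 = 0.
Proof. by rewrite /oddp oppr0 subrr. Qed.

Lemma is_derive_id_X n r : is_derive r 1 (fun x : R => x ^+ n) (n%:R * r ^+ n.-1).
Proof.
apply: (is_derive_ext _ (is_deriveX n (is_derive_id r (1 : R)))).
  by move=> x; rewrite exprfctE.
by rewrite /GRing.scale /= mulr1.
Qed.

Lemma mvt_from0 f (df : R -> R) r : (forall x : R, is_derive x 1 f (df x)) ->
  exists2 c, `|c| <= `|r| & f r - f 0 = df c * r.
Proof.
move=> fdf; have cf : continuous f.
  by move=> x; apply/differentiable_continuous/derivable1_diffP; have [] := fdf x.
have wcf a b : {within `[a, b], continuous f} by exact: continuous_subspaceT.
have [r0|/ltW r0] := leP 0 r.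
  have [c] := MVT_segment r0 (fun x _ => fdf x) (wcf _ _).
  rewrite in_itv/= subr0 => /andP[c0 cr] E; exists c => //.
  by rewrite !ger0_norm.
have [c] := MVT_segment r0 (fun x _ => fdf x) (wcf _ _).
rewrite in_itv/= sub0r => /andP[rc c0] E; exists c; last first.
  by rewrite -opprB E mulrN opprK.
by rewrite !ler0_norm// lerN2.
Qed.

(** The value at the origin makes the quotient smooth when [o] is smooth and
    vanishes there. *)
Definition quot o r : R := if r == 0 then derive1 o 0 else o r / r.

(** A primitive of [r^n o^(n+1)(r)], obtained by repeated integration by parts. *)
Fixpoint quot_primitive o n r : R :=
  if n is m.+1 then r ^+ n * derive1n n o r - n%:R * quot_primitive o m r
  else o r.

(** The derivative of order [n] of [o(r)/r].  From [o(r)/r = int_0^1 o'(t r) dt] it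
    is [int_0^1 t^n o^(n+1)(t r) dt], which is the expression below after the
    substitution [s = t r]. *)
Definition quotn o n r : R :=
  if r == 0 then derive1n n.+1 o 0 / n.+1%:R
  else quot_primitive o n r / r ^+ n.+1.

Lemma quot_primitive_is_derive o n r : smooth1 o ->
  is_derive r 1 (quot_primitive o n) (r ^+ n * derive1n n.+1 o r).
Proof.
move=> so; elim: n => [|n IH].
  by rewrite expr0 mul1r; exact: (smooth1_is_derive 0 r so).
apply: (is_derive_ext _ (is_deriveB (is_deriveM (is_derive_id_X n.+1 r)
  (smooth1_is_derive n.+1 r so)) (is_deriveZ n.+1%:R IH))) => //.
by rewrite /GRing.scale /=; ring.
Qed.

Lemma quot_primitive0 o n : o 0 = 0 -> quot_primitive o n 0 = 0.
Proof.
by move=> o0; elim: n => [//|n IH]; rewrite /= IH expr0n /= mul0r mulr0 subrr.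
Qed.

(** Averaging against [t^n] turns an affine approximation [A + B s] of [o^(n+1)] on
    the interval between [-r] and [r] into an equally good approximation of the
    quotient.  The integral is avoided by applying the mean value theorem to [P]. *)
Lemma quotn_approx o n (r A B K : R) : smooth1 o -> o 0 = 0 -> r != 0 ->
  (forall s, `|s| <= `|r| -> `|derive1n n.+1 o s - A - B * s| <= K) ->
  `|quotn o n r - A / n.+1%:R - B * r / n.+2%:R| <= K.
Proof.
move=> so o0 r0 oK.
pose P s := quot_primitive o n s - A / n.+1%:R * s ^+ n.+1 - B / n.+2%:R * s ^+ n.+2.
have dP (s : R) : is_derive s 1 P (s ^+ n * (derive1n n.+1 o s - A - B * s)).
  apply: (is_derive_ext _ (is_deriveB (is_deriveB
    (quot_primitive_is_derive n s so)
    (is_deriveZ (A / n.+1%:R) (is_derive_id_X n.+1 s)))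
    (is_deriveZ (B / n.+2%:R) (is_derive_id_X n.+2 s)))) => //.
  rewrite /GRing.scale /= exprS; field.
  by rewrite nat1r -natrD !pnatr_eq0.
have [c cr] := mvt_from0 r dP.
rewrite {2}/P quot_primitive0// !expr0n /= !mulr0 !subr0 => Pr.
have rn0 : r ^+ n.+1 != 0 by rewrite expf_neq0.
have -> : quotn o n r - A / n.+1%:R - B * r / n.+2%:R = P r / r ^+ n.+1.
  rewrite /P /quotn (negbTE r0) !exprS.
  have rn : r ^+ n != 0 by rewrite expf_neq0.
  field; rewrite ?nat1r -?natrD ?pnatr_eq0 ?r0 ?rn //.
rewrite normrM normfV ler_pdivrMr ?normr_gt0// Pr !normrM normrX [leRHS]mulrC.
rewrite [X in _ <= X * _]normrX exprSr -mulrA [leRHS]mulrAC -mulrA ler_pM//.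
  by rewrite lerXn2r// nnegrE.
by rewrite ler_wpM2r// (oK _ cr).
Qed.

Lemma quotn_bound o n r K : smooth1 o -> o 0 = 0 ->
  (forall s, `|s| <= `|r| -> `|derive1n n.+1 o s| <= K) ->
  `|quotn o n r| <= K.
Proof.
move=> so o0 oK; have [->|r0] := eqVneq r 0.
  rewrite /quotn eqxx normrM normfV (ger0_norm (ler0n _ n.+1)) ler_pdivrMr//.
  have := oK 0; rewrite normr0 normr_ge0 => /(_ isT) h.
  by rewrite (le_trans h)// ler_peMr ?(le_trans _ h)// ler1n.
have := @quotn_approx o n r 0 0 K so o0 r0.
rewrite !mul0r !subr0; apply => s sr.
by rewrite mul0r !subr0 oK.
Qed.

(** Away from the origin this is the quotient rule.  At the origin the affine
    approximation of [o^(n+1)] given by its derivative is carried to [quotn o n]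
    by [quotn_approx]. *)
Lemma quotn_is_derive o n r : smooth1 o -> o 0 = 0 ->
  is_derive r 1 (quotn o n) (quotn o n.+1 r).
Proof.
move=> so o0; have [->|r0] := eqVneq r 0; last first.
  have rn0 k : r ^+ k != 0 by rewrite expf_neq0.
  apply: (@near_eq_is_derive _ _ _
    (fun x : R => quot_primitive o n x * (x ^+ n.+1)^-1)).
    near=> x; rewrite /quotn; case: eqP => // x0.
    have : x != 0 by near: x; exact: (cvgr_neq0 r).
    by rewrite x0 eqxx.
  have dV := @is_deriveV _ (fun x : R => x ^+ n.+1) _ _ _ (rn0 n.+1)
    (is_derive_id_X n.+1 r).
  apply: (is_derive_ext _ (is_deriveM (quot_primitive_is_derive n r so) dV)) => //.
  rewrite /GRing.scale /quotn (negbTE r0) /= !exprS.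
  field; by rewrite r0 rn0.
set A := derive1n n.+1 o 0; set B := derive1n n.+2 o 0.
rewrite {2}/quotn eqxx -/B.
suff h : (fun h => h^-1 *: (quotn o n (h *: 1 + 0) - quotn o n 0)) @ 0^' -->
    B / n.+2%:R.
  apply: DeriveDef; first by apply/cvg_ex; eexists; exact: h.
  by apply/cvg_lim.
apply/cvgrPdist_le => e e0.
have := smooth1_is_derive n.+1 0 so => -[dA] /esym eB.
have := dA; rewrite /derivable => /cvg_ex[l hl].
have lB : l = B by rewrite /B eB; apply/esym/cvg_lim.
rewrite {}lB in hl; clear dA eB.
move/cvgrPdist_le : hl => /(_ e e0)[d /= d0 hd].
exists d => //= h; rewrite /ball_ /= sub0r normrN => hd' h0.
rewrite scaler1 addr0.
have approx : `|quotn o n h - A / n.+1%:R - B * h / n.+2%:R| <= e * `|h|.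
  apply: quotn_approx => // s sh.
  have [->|s0] := eqVneq s 0.
    by rewrite mulr0 subr0 subrr normr0 mulr_ge0// ltW.
  have := hd s; rewrite /= sub0r normrN (le_lt_trans sh hd') => /(_ isT s0).
  rewrite scaler1 addr0 => h1.
  rewrite (le_trans _ (ler_wpM2l (ltW e0) sh))//.
  have -> : derive1n n.+1 o s - A - B * s =
      - (s * (B - s^-1 * (derive1n n.+1 o s - A))) by field.
  by rewrite normrN normrM mulrC ler_wpM2r.
rewrite -normrN opprB -(ler_pM2r (_ : 0 < `|h|)) ?normr_gt0// -normrM.
apply: le_trans approx; rewrite le_eqVlt; apply/orP; left; apply/eqP.
congr (`| _ |); rewrite /GRing.scale /= [quotn o n 0]/quotn eqxx -/A.
field; by rewrite nat1r -natrD !pnatr_eq0 h0.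
Unshelve. all: end_near. Qed.

Lemma derive1n_quot o : smooth1 o -> o 0 = 0 ->
  smooth1 (quot o) /\ forall n, derive1n n (quot o) = quotn o n.
Proof.
move=> so o0; apply: derive1nP => [|n r]; last exact: quotn_is_derive.
apply/funext => r; rewrite /quotn /quot /=.
by case: eqP => // _; rewrite ?divr1 ?expr1.
Qed.

Lemma quotnS o n r : r != 0 ->
  quotn o n.+1 r = (derive1n n.+1 o r - n.+1%:R * quotn o n r) / r.
Proof.
move=> r0; rewrite /quotn (negbTE r0) /= !exprS.
have rn : r ^+ n != 0 by rewrite expf_neq0.
by field; rewrite r0 rn.
Qed.

Definition derivatives_le o (J N : nat) B : Prop :=
  forall n r, (n <= J)%N -> (1 + `|r|) ^+ N * `|derive1n n o r| <= B.

Lemma weight_ge1 r N : 1 <= (1 + `|r|) ^+ N.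
Proof. by rewrite exprn_ege1// lerDl. Qed.

Lemma derivatives_leW o J J' N N' B : (J <= J')%N -> (N <= N')%N ->
  derivatives_le o J' N' B -> derivatives_le o J N B.
Proof.
move=> JJ' NN' h n r nJ; apply: le_trans (h n r (leq_trans nJ JJ')).
by rewrite ler_wpM2r// ler_weXn2l// lerDl.
Qed.

(** For [|r| <= 1] the weight is bounded and the integral form is controlled by the
    next derivative of [o]; for [|r| > 1] the division by [r] only improves the
    bounds ([quotnS]). *)
Lemma quot_derivatives_le J N : exists2 C, 0 <= C & forall o B,
  smooth1 o -> o 0 = 0 -> derivatives_le o J.+1 N B ->
  derivatives_le (quot o) J N (C * B).
Proof.
suff h n : exists2 C, 0 <= C & forall o B, smooth1 o -> o 0 = 0 ->
    derivatives_le o n.+1 N B -> forall r, (1 + `|r|) ^+ N * `|quotn o n r| <= C * B.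
  elim: J => [|J [C C0 IH]].
    have [C C0 hC] := h 0%N; exists C => // o B so o0 oB n r.
    by rewrite leqn0 => /eqP ->; rewrite (derive1n_quot so o0).2; exact: hC.
  have [C' C'0 hC'] := h J.+1; exists (C + C'); rewrite ?addr_ge0// => o B so o0 oB.
  have B0 : 0 <= B.
    by apply: le_trans (oB 0%N 0 _) => //; rewrite mulr_ge0// exprn_ge0// addr_ge0.
  move=> n r; rewrite leq_eqVlt ltnS mulrDl => /predU1P[->|nJ].
    rewrite (derive1n_quot so o0).2 (le_trans (hC' o B so o0 oB r))//.
    by rewrite lerDr mulr_ge0.
  rewrite (le_trans (IH o B so o0 _ n r nJ)) ?lerDl ?mulr_ge0//.
  exact: derivatives_leW oB.
have near0 m o B r : smooth1 o -> o 0 = 0 -> derivatives_le o m.+1 N B ->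
    `|r| <= 1 -> (1 + `|r|) ^+ N * `|quotn o m r| <= 2 ^+ N * B.
  move=> so o0 oB r1; rewrite ler_pM//.
    by rewrite lerXn2r// ?nnegrE ?addr_ge0//; lra.
  apply: quotn_bound => // s _; apply: le_trans (oB m.+1 s (leqnn _)).
  by rewrite ler_peMl// weight_ge1.
have w0 r : 0 <= (1 + `|r|) ^+ N by rewrite exprn_ge0// addr_ge0.
elim: n => [|n [C C0 IH]].
  exists (2 ^+ N + 1) => [|o B so o0 oB r]; first by rewrite addr_ge0// exprn_ge0.
  have B0 : 0 <= B by apply: le_trans (oB 0%N 0 _) => //; rewrite mulr_ge0.
  rewrite mulrDl mul1r; have [r1|r1] := leP `|r| 1.
    by rewrite (le_trans (near0 _ _ _ _ so o0 oB r1))// lerDl.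
  have r0 : r != 0 by rewrite -normr_gt0; lra.
  rewrite (@le_trans _ _ B) ?lerDr ?mulr_ge0 ?exprn_ge0//.
  apply: le_trans (oB 0%N r _) => //; rewrite ler_wpM2l//.
  rewrite /quotn (negbTE r0) /= expr1 normrM normfV ler_pdivrMr; last by lra.
  by rewrite ler_peMr//; lra.
exists (2 ^+ N + (1 + n.+1%:R * C)) => [|o B so o0 oB r].
  by rewrite !addr_ge0// ?exprn_ge0// mulr_ge0.
have B0 : 0 <= B by apply: le_trans (oB 0%N 0 _) => //; rewrite mulr_ge0.
rewrite mulrDl; have [r1|r1] := leP `|r| 1.
  by rewrite (le_trans (near0 _ _ _ _ so o0 oB r1))// lerDl !mulr_ge0// addr_ge0// mulr_ge0.
have r0 : r != 0 by rewrite -normr_gt0; lra.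
rewrite (@le_trans _ _ ((1 + n.+1%:R * C) * B)) ?lerDr ?mulr_ge0 ?exprn_ge0//.
rewrite quotnS// normrM normfV mulrA ler_pdivrMr; last by lra.
rewrite (@le_trans _ _ ((1 + n.+1%:R * C) * B))//; last first.
  by rewrite ler_peMr// ?mulr_ge0// ?addr_ge0// ?mulr_ge0//; lra.
rewrite (le_trans (ler_wpM2l (w0 r) (ler_normB _ _)))// mulrDr mulrDl mul1r lerD//.
  by apply: oB.
rewrite normrM (ger0_norm (ler0n _ _)) mulrCA -mulrA ler_wpM2l//.
by apply: IH => //; exact: derivatives_leW oB.
Qed.

(** Smooth even functions of the line are the profiles of the smooth radial
    functions of the space. *)
Definition smooth_even e : Prop := smooth1 e /\ forall r, e (- r) = e r.

Definition smooth_odd o : Prop := smooth1 o /\ forall r, o (- r) = - o r.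

Lemma smooth_odd0 o : smooth_odd o -> o 0 = 0.
Proof. by move=> [_ oN]; have := oN 0; rewrite oppr0; lra. Qed.

Lemma smooth_odd_oddp f : smooth1 f -> smooth_odd (oddp f).
Proof. by move=> sf; split; [exact: (derive1n_oddp sf).1|exact: oddpN]. Qed.

Lemma smooth_even_derive1 e : smooth_even e -> smooth_odd (derive1 e).
Proof.
move=> [se eN]; split=> [|r]; first exact: smooth1_derive1.
have h1 := smooth1_is_derive 0 (- r) se.
have := is_derive1_oppr h1 => -[_ h2].
rewrite -[LHS]opprK -[RHS]/(- derive1 e r); congr (- _).
rewrite [RHS]derive1E; apply: etrans (esym h2) _; congr ('D_1 _ r).
by apply/funext => x /=; exact: eN.
Qed.

Lemma smooth_even_quot o : smooth_odd o -> smooth_even (quot o).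
Proof.
move=> oo; have o0 := smooth_odd0 oo; have [so oN] := oo.
split=> [|r]; first exact: (derive1n_quot so o0).1.
rewrite /quot oppr_eq0; case: eqP => // _.
by rewrite oN invrN mulrNN.
Qed.

(** The operator [(1/r) d/dr]; it is applied to even functions, whose derivatives
    vanish at the origin. *)
Definition rderive e : R -> R := quot (derive1 e).

Lemma smooth_even_iter_rderive j e :
  smooth_even e -> smooth_even (iter j rderive e).
Proof.
move=> ee; elim: j => //= j IH.
exact/smooth_even_quot/smooth_even_derive1.
Qed.

(** Every application of the operator costs two derivatives. *)
Lemma iter_rderive_le j J N : exists2 C, 0 <= C & forall e B, smooth_even e ->
  derivatives_le e (J + j.*2) N B -> derivatives_le (iter j rderive e) J N (C * B).
Proof.
elim: j J => [|j IH] J.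
  by exists 1 => // e B _; rewrite addn0 mul1r.
have [C C0 hC] := IH J.+2; have [C' C'0 hC'] := quot_derivatives_le J N.
exists (C' * C); rewrite ?mulr_ge0// => e B ee eB; rewrite -mulrA.
have ed := smooth_even_derive1 (smooth_even_iter_rderive j ee).
apply: hC'; [exact: ed.1|exact: smooth_odd0|].
move=> n r nJ; rewrite -derive1Sn; apply: hC => //.
by rewrite doubleS -!addSnnS in eB.
Qed.

End SmoothFunctionsOnTheLine.

Arguments rderive {R} e _.
Arguments quot {R} o r.

(** * Smooth radial functions *)
Section RadialFunctions.
Variables (R : realType) (k : nat).
Implicit Types (x y v w : 'rV[R]_k) (e : R -> R).

Lemma dotpC x y : dotp x y = dotp y x.
Proof. by apply: eq_bigr => i _; rewrite mulrC. Qed.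

Lemma dotpDl x y w : dotp (x + y) w = dotp x w + dotp y w.
Proof. by rewrite -big_split; apply: eq_bigr => i _; rewrite mxE mulrDl. Qed.

Lemma dotpZl c x w : dotp (c *: x) w = c * dotp x w.
Proof. by rewrite mulr_sumr; apply: eq_bigr => i _; rewrite mxE mulrA. Qed.

Lemma dotp0l w : dotp 0 w = 0.
Proof. by rewrite -(scale0r 0) dotpZl mul0r. Qed.

Lemma dotpDr x y w : dotp w (x + y) = dotp w x + dotp w y.
Proof. by rewrite dotpC dotpDl !(dotpC _ w). Qed.

Lemma dotpZr c x w : dotp w (c *: x) = c * dotp w x.
Proof. by rewrite dotpC dotpZl (dotpC _ w). Qed.

Lemma dotp_ge0 x : 0 <= dotp x x.
Proof. by apply: sumr_ge0 => i _; rewrite -expr2 sqr_ge0. Qed.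

Lemma enorm_ge0 x : 0 <= enorm x. Proof. exact: sqrtr_ge0. Qed.

Lemma enorm_sqr x : enorm x ^+ 2 = dotp x x.
Proof. by rewrite sqr_sqrtr// dotp_ge0. Qed.

Lemma dotp_eq0 x : (dotp x x == 0) = (x == 0).
Proof.
apply/eqP/eqP => [|->]; last by rewrite /dotp big1// => i _; rewrite mxE mul0r.
move/eqP; rewrite psumr_eq0 => [/allP h|i _]; last by rewrite -expr2 sqr_ge0.
apply/rowP => i; rewrite mxE; have := h i (mem_index_enum _).
by rewrite -expr2 sqrf_eq0 => /eqP.
Qed.

Lemma enorm_eq0 x : (enorm x == 0) = (x == 0).
Proof. by rewrite -dotp_eq0 -enorm_sqr sqrf_eq0. Qed.

Lemma norm_coord_le x i : `|x 0 i| <= `|x|.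
Proof.
rewrite [leRHS](mx_normrE x).
exact: (le_bigmax _ (fun ij : 'I_1 * 'I_k => `|x ij.1 ij.2|) (0, i)).
Qed.

Lemma norm_le_enorm x : `|x| <= enorm x.
Proof.
rewrite [leLHS](mx_normrE x); apply: bigmax_le => [|[i j] _ /=].
  exact: enorm_ge0.
rewrite ord1 -sqrtr_sqr ler_sqrt ?dotp_ge0// /dotp (bigD1 j)//= -expr2 lerDl.
by apply: sumr_ge0 => l _; rewrite -expr2 sqr_ge0.
Qed.

Lemma normr_dotp_le x w : `|dotp x w| <= (\sum_i `|w 0 i|) * `|x|.
Proof.
rewrite (le_trans (ler_norm_sum _ _ _))// mulr_suml ler_sum// => i _.
by rewrite normrM mulrC ler_wpM2l// norm_coord_le.
Qed.

Lemma continuous_sumr (T : topologicalType) (I : Type) (r : seq I)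
    (F : I -> T -> R) : (forall i, continuous (F i)) ->
  continuous (fun t => \sum_(i <- r) F i t).
Proof.
move=> cF; elim: r => [|i r IH].
  by under eq_fun do rewrite big_nil; move=> t; exact: cvg_cst.
under eq_fun do rewrite big_cons; move=> t.
by apply: cvgD; [exact: cF|exact: IH].
Qed.

Lemma continuous_dotp w : continuous (fun x => dotp x w).
Proof.
apply: continuous_sumr => i x.
have h : continuous (fun t : 'rV[R]_k => t 0 i) by exact: coord_continuous.
exact: (cvgM (h x) (cvg_cst _)).
Qed.

Lemma continuous_enorm : continuous (@enorm R k).
Proof.
move=> x; apply: (continuous_comp (f := fun x => dotp x x)); last exact: sqrt_continuous.
apply: continuous_sumr => i y.
have h : continuous (fun t : 'rV[R]_k => t 0 i) by exact: coord_continuous.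
exact: (cvgM (h y) (h y)).
Qed.

Lemma is_derive_line (W : normedModType R) (f : 'rV[R]_k -> W) x v d :
  is_derive (0 : R) 1 (fun h : R => f (h *: v + x)) d -> is_derive x v f d.
Proof.
move=> [dg <-]; apply: DeriveDef; first exact/derivable1P.
rewrite /derive; set g1 := fun h => _; set g2 := fun h => _.
suff -> : g1 = g2 by [].
apply/funext => h; rewrite /g1 /g2 /=.
by rewrite scaler1 !addr0 scale0r add0r.
Qed.

(** The gradient of [e(|x|)] is [(e'(|x|)/|x|) x].  At the origin, where the norm is
    not differentiable, evenness allows [e(|h| |v|)] to be replaced by [e(h |v|)]. *)
Lemma is_derive_radial e x v : smooth_even e ->
  is_derive x v (fun y => e (enorm y)) (dotp x v * rderive e (enorm x)).
Proof.
move=> ee; have [se eN] := ee; apply: is_derive_line.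
have de r := smooth1_is_derive 0 r se.
have [->|x0] := eqVneq x 0.
  have -> : dotp 0 v * rderive e (enorm (0 : 'rV[R]_k)) = derive1 e 0 * enorm v.
    by rewrite (smooth_odd0 (smooth_even_derive1 ee)) dotp0l !mul0r.
  have dl : is_derive (0 : R) 1 (fun h : R => h * enorm v) (enorm v).
    apply: (is_derive_ext _ (is_deriveM (is_derive_id 0 (1 : R))
      (is_derive_cst (enorm v) 0 (1 : R)))) => //.
    by rewrite scaler0 add0r /GRing.scale /= mulr1.
  have := @is_derive1_comp R e (fun h => h * enorm v) 0 _ _ (de _) dl.
  rewrite mul0r => h; apply: (is_derive_ext _ h) => // t /=.
  rewrite addr0 /enorm dotpZl dotpZr mulrA -expr2 sqrtrM ?sqr_ge0// sqrtr_sqr.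
  by case: (ler0P t) => _; rewrite ?mulNr ?eN.
have q0 : 0 < dotp x x by rewrite lt_neqAle dotp_ge0 andbT eq_sym dotp_eq0.
pose q (h : R) := dotp x x + 2 * dotp x v * h + dotp v v * h ^+ 2.
have q00 : q 0 = dotp x x by rewrite /q expr0n/= !mulr0 !addr0.
have dq : is_derive (0 : R) 1 q (2 * dotp x v).
  apply: (is_derive_ext _ (is_deriveD (is_deriveD (is_derive_cst (dotp x x) 0 (1 : R))
    (is_deriveZ (2 * dotp x v) (is_derive_id 0 (1 : R))))
    (is_deriveZ (dotp v v) (is_derive_id_X 2 0)))) => //.
  by rewrite /GRing.scale /= !(mulr0, mulr1, add0r, addr0).
have ds : is_derive (q 0) 1 Num.sqrt (2 * Num.sqrt (q 0))^-1.
  by apply: is_derive1_sqrt; rewrite q00.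
have h := @is_derive1_comp R e (Num.sqrt \o q) 0 _ _ (de _) (is_derive1_comp ds dq).
apply: (is_derive_ext _ h) => [t|] /=.
  congr e; congr Num.sqrt; rewrite /q dotpDl !dotpDr !dotpZl !dotpZr (dotpC v x).
  by ring.
rewrite q00 /rderive /quot -/(enorm x) enorm_eq0 (negbTE x0).
change (derive1 e (enorm x) * ((2 * enorm x)^-1 * (2 * dotp x v)) =
  dotp x v * (derive1 e (enorm x) / enorm x)).
have n0 : enorm x != 0 by rewrite enorm_eq0.
by field.
Qed.

(** The operators that produce the iterated derivatives of [e(|x|)] from [e].  The
    family is stable under directional derivatives, and every division by [|x|]
    is hidden in the smooth even functions [iter j rderive e]; therefore each
    constructor preserves continuity and decay. *)
Inductive radial_operator : ((R -> R) -> 'rV[R]_k -> R) -> Prop :=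
| RadialBase j : radial_operator (fun e x => iter j rderive e (enorm x))
| RadialDotp w F : radial_operator F -> radial_operator (fun e x => dotp x w * F e x)
| RadialScale c F : radial_operator F -> radial_operator (fun e x => c * F e x)
| RadialAdd F G : radial_operator F -> radial_operator G ->
    radial_operator (fun e x => F e x + G e x).

Lemma is_derive_dotp w x v : is_derive x v (fun y => dotp y w) (dotp v w).
Proof.
apply: is_derive_line.
apply: (is_derive_ext _ (is_deriveD (is_deriveM (is_derive_id 0 (1 : R))
  (is_derive_cst (dotp v w) 0 (1 : R))) (is_derive_cst (dotp x w) 0 (1 : R)))).
  by move=> h; rewrite dotpDl dotpZl.
by rewrite /GRing.scale /= !(mulr0, mulr1, add0r, addr0).
Qed.

Lemma radial_operator_derive F v : radial_operator F ->
  exists2 G, radial_operator G &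
    forall e x, smooth_even e -> is_derive x v (F e) (G e x).
Proof.
elim=> [j|w {}F rF [G rG dF]|c {}F _ [G rG dF]|{}F G _ [F' rF' dF] _ [G' rG' dG]].
- exists (fun e x => dotp x v * iter j.+1 rderive e (enorm x)).
    exact/RadialDotp/RadialBase.
  by move=> e x ee; exact/is_derive_radial/smooth_even_iter_rderive.
- exists (fun e x => dotp v w * F e x + dotp x w * G e x).
    exact/RadialAdd/RadialDotp/rG/RadialScale.
  move=> e x /(dF _ x) dFx.
  apply: (is_derive_ext _ (is_deriveM (is_derive_dotp w x v) dFx)) => //.
  by rewrite /GRing.scale /= addrC mulrC.
- exists (fun e x => c * G e x); first exact: RadialScale.
  by move=> e x /(dF _ x) dFx; exact: is_deriveZ.
- exists (fun e x => F' e x + G' e x); first exact: RadialAdd.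
  by move=> e x ee; exact: is_deriveD (dF _ x ee) (dG _ x ee).
Qed.

Lemma radial_operator_continuous F e : radial_operator F -> smooth_even e ->
  continuous (F e).
Proof.
move=> rF ee; elim: rF => [j|w {}F _ IH|c {}F _ IH|{}F G _ IHF _ IHG] x.
- have [se _] := smooth_even_iter_rderive j ee.
  apply: (continuous_comp (f := @enorm R k)); first exact: continuous_enorm.
  have h := @smooth1_continuous R _ 0 se; exact: (h (enorm x)).
- exact: (cvgM (@continuous_dotp w x) (IH x)).
- exact: (cvgM (cvg_cst _) (IH x)).
- exact: (cvgD (IHF x) (IHG x)).
Qed.

(** A factor [dotp x w] costs one power of the weight, and [j] applications of
    [rderive] cost [2j] derivatives. *)
Lemma radial_operator_le F N : radial_operator F ->
  exists (C : R) (J M : nat), 0 <= C /\ forall e B, smooth_even e ->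
    derivatives_le e J M B ->
    forall x, (1 + `|x|) ^+ N * `|F e x| <= C * B.
Proof.
move=> rF; elim: rF N => [j|w {}F _ IH|c {}F _ IH|{}F G _ IHF _ IHG] N.
- have [C C0 hC] := @iter_rderive_le R j 0 N.
  exists C, j.*2, N; split=> // e B ee eB x.
  have /(_ 0%N (enorm x)) := hC e B ee eB; rewrite leqnn => /(_ isT).
  apply: le_trans; rewrite ler_wpM2r// lerXn2r ?nnegrE ?addr_ge0//.
  by rewrite lerD2l (ger0_norm (enorm_ge0 x)) norm_le_enorm.
- have [C [J [M [C0 hC]]]] := IH N.+1.
  exists ((\sum_i `|w 0 i|) * C), J, M; split; first by rewrite mulr_ge0// sumr_ge0.
  move=> e B ee eB x; rewrite -mulrA.
  apply: le_trans (ler_wpM2l (sumr_ge0 _ (fun i _ => normr_ge0 (w 0 i))) (hC e B ee eB x)).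
  rewrite normrM exprS -mulrA [leRHS]mulrA mulrCA ler_wpM2r//.
  rewrite (le_trans (normr_dotp_le x w))// ler_wpM2l ?sumr_ge0//.
  by rewrite lerDr.
- have [C [J [M [C0 hC]]]] := IH N.
  exists (`|c| * C), J, M; split; first by rewrite mulr_ge0.
  move=> e B ee eB x; rewrite normrM mulrCA -mulrA ler_wpM2l//; exact: hC.
- have [C [J [M [C0 hC]]]] := IHF N; have [C' [J' [M' [C0' hC']]]] := IHG N.
  exists (C + C'), (maxn J J'), (maxn M M'); split; first by rewrite addr_ge0.
  move=> e B ee eB x; rewrite mulrDl.
  have w0 : 0 <= (1 + `|x|) ^+ N by rewrite exprn_ge0// addr_ge0.
  rewrite (le_trans (ler_wpM2l w0 (ler_normD _ _)))// mulrDr lerD//.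
    by apply: hC => //; apply: derivatives_leW eB; exact: leq_maxl.
  by apply: hC' => //; apply: derivatives_leW eB; exact: leq_maxr.
Qed.

End RadialFunctions.

Local Open Scope complex_scope.

(** * Complex-valued smooth, test and Schwartz functions *)
Section ComplexValuedSmoothFunctions.
Variables (R : realType) (V : normedModType R).
Implicit Types (f g : V -> R[i]) (p q : V -> R) (x v : V) (vs : seq V).

Definition rderives vs p : V -> R := foldr (fun v q x => 'D_v q x) p vs.

Definition rsmooth p : Prop := forall vs,
  continuous (rderives vs p) /\ forall x v, derivable (rderives vs p) x v.

Lemma cderivesE vs f x : cderives vs f x =
  rderives vs (fun y => complex.Re (f y)) x +i*
  rderives vs (fun y => complex.Im (f y)) x.
Proof.
elim: vs x => [|v vs IH] x; first by rewrite /=; case: (f x).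
rewrite /= /cderive; congr (_ +i* _); congr ('D_v _ x); apply/funext => y.
  by rewrite -/(cderives vs f y) IH.
by rewrite -/(cderives vs f y) IH.
Qed.

Lemma Re_cderives vs f : (fun x => complex.Re (cderives vs f x)) =
  rderives vs (fun y => complex.Re (f y)).
Proof. by apply/funext => x; rewrite cderivesE. Qed.

Lemma Im_cderives vs f : (fun x => complex.Im (cderives vs f x)) =
  rderives vs (fun y => complex.Im (f y)).
Proof. by apply/funext => x; rewrite cderivesE. Qed.

Lemma smoothP f : smooth f <->
  rsmooth (fun x => complex.Re (f x)) /\ rsmooth (fun x => complex.Im (f x)).
Proof.
split=> [sf|[sr si] vs].
  by split=> vs; have [[]] := sf vs; rewrite Re_cderives Im_cderives => c1 c2 d;
    split=> // x v; have [] := d x v; rewrite Re_cderives Im_cderives.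
have [c1 d1] := sr vs; have [c2 d2] := si vs.
split; first by split; rewrite ?Re_cderives ?Im_cderives.
by move=> x v; rewrite Re_cderives Im_cderives.
Qed.

Lemma rderives_lin vs (c : R) p q : rsmooth p -> rsmooth q ->
  rderives vs (fun x => c * p x + q x) =
  fun x => c * rderives vs p x + rderives vs q x.
Proof.
move=> sp sq; elim: vs => [//|v vs IH] /=; rewrite IH; apply/funext => x.
have [_ dp] := sp vs; have [_ dq] := sq vs.
have h : is_derive x v (fun x => c * rderives vs p x + rderives vs q x)
    (c * 'D_v (rderives vs p) x + 'D_v (rderives vs q) x).
  exact: (is_deriveD (is_deriveZ c (derivableP (dp x v))) (derivableP (dq x v))).
by rewrite (@derive_val _ _ _ _ _ _ _ h).
Qed.

Lemma rsmooth_lin (c : R) p q : rsmooth p -> rsmooth q ->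
  rsmooth (fun x => c * p x + q x).
Proof.
move=> sp sq vs; rewrite rderives_lin//.
have [cp dp] := sp vs; have [cq dq] := sq vs; split=> x.
  exact: (cvgD (cvgM (cvg_cst c) (cp x)) (cq x)).
move=> v; have h := is_deriveD (is_deriveZ c (derivableP (dp x v))) (derivableP (dq x v)).
by case: h.
Qed.

Lemma smooth_lin (c : R[i]) f g : smooth f -> smooth g ->
  smooth (fun x => c * f x + g x).
Proof.
move=> /smoothP[fr fi] /smoothP[gr gi]; apply/smoothP; case: c => a b; split.
  have -> : (fun x => complex.Re ((a +i* b)%C * f x + g x)) =
    (fun x => a * complex.Re (f x) + (- b * complex.Im (f x) + complex.Re (g x))).
    by apply/funext => x; case: (f x) (g x) => [u w] [u' w'] /=; ring.
  exact: (rsmooth_lin _ fr (rsmooth_lin _ fi gr)).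
have -> : (fun x => complex.Im ((a +i* b)%C * f x + g x)) =
    (fun x => a * complex.Im (f x) + (b * complex.Re (f x) + complex.Im (g x))).
  by apply/funext => x; case: (f x) (g x) => [u w] [u' w'] /=; ring.
exact: (rsmooth_lin _ fi (rsmooth_lin _ fr gi)).
Qed.

Lemma fsupport_sub f (A : set V) : closed A -> (forall x, f x != 0 -> A x) ->
  fsupport f `<=` A.
Proof.
by move=> cA fA; rewrite [X in _ `<=` X](closure_id _).1//; exact: closure_subset.
Qed.

Lemma test_function_lin (c : R[i]) f g : test_function f -> test_function g ->
  test_function (fun x => c * f x + g x).
Proof.
move=> [sf kf] [sg kg]; split; first exact: smooth_lin.
apply: (subclosed_compact _ (compactU kf kg)); first exact: closed_closure.
apply: fsupport_sub => [|x].
  by apply: closedU; exact: closed_closure.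
have [fx0|fx0 _] := eqVneq (f x) 0; last by left; exact: subset_closure.
by rewrite fx0 mulr0 add0r => gx0; right; exact: subset_closure.
Qed.

Lemma rderives_off vs p (U : set V) : open U -> (forall x, U x -> p x = 0) ->
  forall x, U x -> rderives vs p x = 0.
Proof.
move=> oU pU; elim: vs => [//|v vs IH] x Ux /=.
rewrite (@near_eq_derive _ _ _ _ (cst 0)); first exact: derive_cst.
by apply: filterS (open_nbhs_nbhs (conj oU Ux)) => y; exact: IH.
Qed.

Lemma cderives_off vs f x : ~ fsupport f x -> cderives vs f x = 0.
Proof.
have oU : open (~` fsupport f) by apply: closed_openC; exact: closed_closure.
have fU y : (~` fsupport f) y -> f y = 0.
  by move=> nfy; apply/eqP; apply: contra_notT nfy => fy; exact: subset_closure.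
by move=> nfx; rewrite cderivesE !(@rderives_off _ _ _ oU)// => y /fU ->.
Qed.

Lemma normc_ge_Re (z : R[i]) : `|complex.Re z| <= Normc.normc z.
Proof.
case: z => a b /=; rewrite -sqrtr_sqr ler_sqrt ?addr_ge0 ?sqr_ge0//.
by rewrite lerDl sqr_ge0.
Qed.

Lemma normc_ge_Im (z : R[i]) : `|complex.Im z| <= Normc.normc z.
Proof.
case: z => a b /=; rewrite -sqrtr_sqr ler_sqrt ?addr_ge0 ?sqr_ge0//.
by rewrite lerDr sqr_ge0.
Qed.

Lemma normc_le (z : R[i]) : Normc.normc z <= `|complex.Re z| + `|complex.Im z|.
Proof.
case: z => a b /=; rewrite -[leRHS]ger0_norm ?addr_ge0// -sqrtr_sqr ler_sqrt ?sqr_ge0//.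
rewrite sqrrD !real_normK ?num_real// addrAC lerDl mulrn_wge0// mulr_ge0//.
Qed.

Lemma normc_ge0 (z : R[i]) : 0 <= Normc.normc z.
Proof. exact: le_trans (normr_ge0 _) (normc_ge_Re z). Qed.

Lemma weighted_ge0 N vs f x : 0 <= weighted N vs f x.
Proof. by rewrite mulr_ge0 ?normc_ge0// exprn_ge0// addr_ge0. Qed.

Lemma weighted_le_seminorm N vs f x : schwartz f ->
  weighted N vs f x <= schwartz_seminorm (N, vs) f.
Proof.
move=> [_ /(_ N vs)[M hM]]; apply: ub_le_sup; last by exists x.
by exists M => _ [y _ <-]; exact: hM.
Qed.

Lemma seminorm_ge0 (i : nat * seq V) f : schwartz f -> 0 <= schwartz_seminorm i f.
Proof.
case: i => N vs sf.
exact: le_trans (weighted_ge0 N vs f 0) (weighted_le_seminorm _ _ _ sf).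
Qed.

Lemma seminorm_le N vs f (M : R) : (forall x, weighted N vs f x <= M) ->
  schwartz_seminorm (N, vs) f <= M.
Proof.
move=> fM; apply: ge_sup; first by exists (weighted N vs f 0), 0.
by move=> _ [x _ <-]; exact: fM.
Qed.

Lemma compact_ubound (K : set V) p : compact K -> continuous p ->
  exists2 M : R, 0 <= M & forall x, K x -> `|p x| <= M.
Proof.
move=> kK cp; have := continuous_compact (continuous_subspaceT cp) kK.
move=> /compact_bounded[M [_ hM]]; exists (`|M| + 1); first by rewrite addr_ge0.
move=> x Kx; apply: (hM (`|M| + 1)); last by exists x.
by rewrite (le_lt_trans (ler_norm M))// ltrDl.
Qed.

Lemma test_function_schwartz f : test_function f -> schwartz f.
Proof.
move=> [sf kf]; split=> // N vs.
have [[c1 c2] _] := sf vs.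
have [M1 M10 h1] := compact_ubound kf c1.
have [M2 M20 h2] := compact_ubound kf c2.
have [B B0 hB] := compact_ubound kf (@norm_continuous R V).
exists ((1 + B) ^+ N * (M1 + M2)) => x.
have [fx|fx] := pselect (fsupport f x).
  rewrite ler_pM ?normc_ge0 ?exprn_ge0 ?addr_ge0//.
    rewrite lerXn2r ?nnegrE ?addr_ge0// lerD2l.
    by have := hB x fx; rewrite normr_id.
  by rewrite (le_trans (normc_le _))// lerD ?h1 ?h2.
rewrite /weighted cderives_off//= expr0n/= addr0 sqrtr0 mulr0.
by rewrite mulr_ge0 ?exprn_ge0 ?addr_ge0.
Qed.

(** A functional with a tempered extension is a distribution: on a fixed compact
    set the polynomial weights are bounded. *)
Lemma schwartz_extension_distribution u T : schwartz_extension u T ->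
  @Defs.distribution R V u.
Proof.
move=> [[lT [C [s hC]]] Tu]; split=> [c f g tf tg|K kK].
  rewrite -!Tu//; last exact: test_function_lin.
  by apply: lT; exact: test_function_schwartz.
have [B B0 hB] := compact_ubound kK (@norm_continuous R V).
suff [C' C'0 h] : exists2 C', 0 <= C' & forall phi, test_function phi ->
    fsupport phi `<=` K -> \sum_(i <- s) schwartz_seminorm i phi <=
    C' * \sum_(vs <- map snd s) schwartz_seminorm (0%N, vs) phi.
  exists (`|C| * C'), (map snd s) => phi tphi sK; rewrite -Tu// -mulrA.
  apply: le_trans (hC _ (test_function_schwartz tphi)) _.
  apply: le_trans (ler_wpM2l _ (h _ tphi sK)) => //.
  rewrite ler_wpM2r ?ler_norm// sumr_ge0// => i _.
  exact/seminorm_ge0/test_function_schwartz.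
elim: s {hC} => [|[N vs] s [C' C'0 IH]]; first by exists 0 => // *; rewrite !big_nil mul0r.
exists ((1 + B) ^+ N + C'); first by rewrite addr_ge0// exprn_ge0// addr_ge0.
move=> phi tphi sK; have sphi := test_function_schwartz tphi.
have S0 : 0 <= \sum_(vs <- map snd s) schwartz_seminorm (0%N, vs) phi.
  by rewrite sumr_ge0// => ? _; exact: seminorm_ge0.
rewrite /= !big_cons mulrDl lerD//; last first.
  by rewrite (le_trans (IH phi tphi sK))// ler_wpM2l// lerDr seminorm_ge0.
apply: (@le_trans _ _ ((1 + B) ^+ N * schwartz_seminorm (0%N, vs) phi)).
  apply: seminorm_le => x; have [px|px] := pselect (fsupport phi x); last first.
    rewrite /weighted cderives_off//= expr0n/= addr0 sqrtr0 mulr0.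
    by rewrite mulr_ge0 ?exprn_ge0 ?addr_ge0// seminorm_ge0.
  rewrite ler_pM ?normc_ge0 ?exprn_ge0 ?addr_ge0//.
    rewrite lerXn2r ?nnegrE ?addr_ge0// lerD2l.
    by have := hB x (sK x px); rewrite normr_id.
  by have := weighted_le_seminorm 0 vs x sphi; rewrite /weighted expr0 mul1r.
by rewrite ler_wpM2l ?exprn_ge0 ?addr_ge0// lerDl.
Qed.

End ComplexValuedSmoothFunctions.

Section SmoothnessOnTheLine.
Variable R : realType.
Implicit Types (p : R -> R) (f : R -> R[i]).

(** On the line the derivative along [v] is [v] times the ordinary derivative, so the
    two notions of smoothness agree ([rsmooth_line]). *)
Lemma is_derive_along p (x v d : R) : is_derive x 1 p d -> is_derive x v p (v * d).
Proof.
move=> [dp dE]; have df : differentiable p x by apply/derivable1_diffP.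
apply: DeriveDef; first exact: diff_derivable.
by rewrite deriveE// -[v]mulr1 linearZ /= -deriveE// dE mulr1.
Qed.

Lemma smooth1_rderives vs p : smooth1 p ->
  rderives vs p = fun x => (\prod_(v <- vs) v) * derive1n (size vs) p x.
Proof.
move=> sp; elim: vs => [|v vs IH].
  by apply/funext => x; rewrite big_nil mul1r.
apply/funext => x; rewrite /= IH big_cons.
have h := is_derive_along v (is_deriveZ (\prod_(w <- vs) w)
  (smooth1_is_derive (size vs) x sp)).
by rewrite (@derive_val _ _ _ _ _ _ _ h) mulrA.
Qed.

Lemma rsmooth_line p : rsmooth p <-> smooth1 p.
Proof.
split=> sp.
  have E n : derive1n n p = rderives (nseq n (1 : R)) p.
    elim: n => [//|n IH]; rewrite derive1nS IH /=.
    by apply/funext => x; rewrite derive1E.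
  by move=> n x; rewrite E; have [_] := sp (nseq n (1 : R)).
move=> vs; rewrite smooth1_rderives//; split=> x.
  by have h := @smooth1_continuous R p (size vs) sp; exact: (cvgM (cvg_cst _) (h x)).
by move=> v; have [] := is_derive_along v (is_deriveZ (\prod_(w <- vs) w)
  (smooth1_is_derive (size vs) x sp)).
Qed.

Lemma smooth_line f : smooth f <->
  smooth1 (fun x => complex.Re (f x)) /\ smooth1 (fun x => complex.Im (f x)).
Proof. by rewrite smoothP !rsmooth_line. Qed.

(** The seminorms along the directions [1, ..., 1] already control all ordinary
    derivatives. *)
Lemma schwartz_derivatives_le f J N : schwartz f ->
  let B := \sum_(vs <- mkseq (fun n => nseq n (1 : R)) J.+1)
    schwartz_seminorm (N, vs) f in
  derivatives_le (fun x => complex.Re (f x)) J N B /\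
  derivatives_le (fun x => complex.Im (f x)) J N B.
Proof.
move=> sf B; have w0 (x : R) : 0 <= (1 + `|x|) ^+ N by rewrite exprn_ge0// addr_ge0.
have [s1 s2] := (smooth_line f).1 sf.1.
have hB n x : (n <= J)%N -> weighted N (nseq n (1 : R)) f x <= B.
  move=> nJ; apply: le_trans (weighted_le_seminorm _ _ _ sf) _.
  rewrite /B (bigD1_seq (nseq n (1 : R))); first last.
  - rewrite map_inj_uniq ?iota_uniq// => a b /(congr1 size).
    by rewrite !size_nseq.
  - by apply/mapP; exists n => //; rewrite mem_iota.
  by rewrite /= lerDl sumr_ge0// => vs _; exact: seminorm_ge0.
have E n p x : smooth1 p -> rderives (nseq n (1 : R)) p x = derive1n n p x.
  by move=> sp; rewrite smooth1_rderives// size_nseq big1_seq ?mul1r// => v /andP[_ /nseqP[]].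
split=> n x nJ; apply: le_trans (hB n x nJ); apply: (ler_wpM2l (w0 x));
  rewrite cderivesE (E _ _ _ s1) (E _ _ _ s2).
  exact: normc_ge_Re (_ +i* _).
exact: normc_ge_Im (_ +i* _).
Qed.

End SmoothnessOnTheLine.

(** * From functions of the line to radial functions *)
Section RadialExtension.
Variables (R : realType) (k : nat).
Implicit Types (e : R -> R) (f : R -> R[i]) (x : 'rV[R]_k).

Lemma radial_rderives (vs : seq 'rV[R]_k) : exists2 F, radial_operator F &
  forall e, smooth_even e -> rderives vs (fun x => e (enorm x)) = F e.
Proof.
elim: vs => [|v vs [F rF hF]].
  by exists (fun e x => e (enorm x)) => //; exact: (@RadialBase R k 0).
have [G rG hG] := radial_operator_derive v rF; exists G => // e ee.
rewrite /= hF//; apply/funext => x; have h := hG e x ee.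
exact: (@derive_val _ _ _ _ _ _ _ h).
Qed.

Lemma rsmooth_radial e : smooth_even e -> rsmooth (fun x => e (enorm x)).
Proof.
move=> ee vs; have [F rF ->//] := radial_rderives vs.
split; first exact: radial_operator_continuous.
move=> x v; have [G _ hG] := radial_operator_derive v rF.
by have [] := hG e x ee.
Qed.

(** The radial function [(f(|x|) - f(-|x|)) / |x|], extended smoothly to the
    origin. *)
Definition radial_quotient f x : R[i] :=
  quot (oddp (fun r => complex.Re (f r))) (enorm x) +i*
  quot (oddp (fun r => complex.Im (f r))) (enorm x).

Lemma smooth_even_quot_oddp (p : R -> R) : smooth1 p -> smooth_even (quot (oddp p)).
Proof. by move=> sp; exact/smooth_even_quot/smooth_odd_oddp. Qed.

Lemma smooth_radial_quotient f : smooth f -> smooth (radial_quotient f).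
Proof.
move=> /smooth_line[sr si]; apply/smoothP; split;
  by apply: rsmooth_radial; exact: smooth_even_quot_oddp.
Qed.

Lemma oddp_derivatives_le (p : R -> R) J N B : smooth1 p -> derivatives_le p J N B ->
  derivatives_le (oddp p) J N (2 * B).
Proof.
move=> sp pB n r nJ; rewrite (derive1n_oddp sp).2.
have w0 : 0 <= (1 + `|r|) ^+ N by rewrite exprn_ge0// addr_ge0.
rewrite (le_trans (ler_wpM2l w0 (ler_normB _ _)))// mulrDr mulrDl mul1r lerD//.
  exact: pB.
rewrite normrM normrX normrN1 expr1n mul1r.
by have := pB n (- r) nJ; rewrite normrN.
Qed.

Lemma weighted_radial_quotient N (vs : seq 'rV[R]_k) :
  exists (C : R) (s : seq (nat * seq R)), 0 <= C /\ forall f, schwartz f ->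
  forall x, weighted N vs (radial_quotient f) x <=
    C * \sum_(i <- s) schwartz_seminorm i f.
Proof.
have [F rF hF] := radial_rderives vs.
have [C [J [M [C0 hC]]]] := radial_operator_le N rF.
have [C' C'0 hC'] := @quot_derivatives_le R J M.
exists (C * (C' * 2) + C * (C' * 2)),
  [seq (M, us) | us <- mkseq (fun n => nseq n (1 : R)) J.+2].
split; first by rewrite addr_ge0 // ?mulr_ge0.
move=> f sf x; rewrite big_map.
have /= := schwartz_derivatives_le J.+1 M sf; set B := (X in derivatives_le _ _ _ X).
move=> [h1 h2]; have [s1 s2] := (smooth_line f).1 sf.1.
have w0 : 0 <= (1 + `|x|) ^+ N by rewrite exprn_ge0// addr_ge0.
have main p : smooth1 p -> derivatives_le p J.+1 M B ->
    (1 + `|x|) ^+ N * `|F (quot (oddp p)) x| <= C * (C' * 2) * B.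
  move=> sp pB; rewrite -mulrA; apply: hC; first exact: smooth_even_quot_oddp.
  rewrite -mulrA; apply: hC'; [|exact: oddp0|exact: oddp_derivatives_le].
  exact: (derive1n_oddp sp).1.
rewrite /weighted cderivesE !hF ?mulrDl; [|exact: smooth_even_quot_oddp..].
apply: le_trans (ler_wpM2l w0 (normc_le _)) _.
by rewrite mulrDr lerD//; exact: main.
Qed.

Lemma schwartz_radial_quotient f : schwartz f -> schwartz (radial_quotient f).
Proof.
move=> sf; split; first exact: smooth_radial_quotient sf.1.
move=> N vs; have [C [s [_ h]]] := weighted_radial_quotient N vs.
by eexists; exact: h.
Qed.

Lemma seminorm_radial_quotient (s : seq (nat * seq 'rV[R]_k)) :
  exists (C : R) (s' : seq (nat * seq R)), 0 <= C /\ forall f, schwartz f ->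
  \sum_(i <- s) schwartz_seminorm i (radial_quotient f) <=
    C * \sum_(i <- s') schwartz_seminorm i f.
Proof.
elim: s => [|[N vs] s [C [s' [C0 IH]]]].
  by exists 0, [::]; split=> // f _; rewrite !big_nil mulr0.
have [C' [t [C'0 h]]] := weighted_radial_quotient N vs.
exists (C' + C), (t ++ s'); split; first by rewrite addr_ge0.
move=> f sf; rewrite big_cons big_cat /= mulrDl.
have S0 u : 0 <= \sum_(i <- u) schwartz_seminorm i f.
  by rewrite sumr_ge0// => i _; exact: seminorm_ge0.
rewrite lerD//.
  apply: (le_trans (seminorm_le (h f sf))).
  by rewrite ler_wpM2l// lerDl.
by rewrite (le_trans (IH f sf))// ler_wpM2l// lerDr.
Qed.

Lemma radial_quotient_lin (c : R[i]) (f g : R -> R[i]) : smooth f -> smooth g ->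
  radial_quotient (fun r => c * f r + g r) =
  fun x => c * radial_quotient f x + radial_quotient g x.
Proof.
move=> /smooth_line[f1 f2] /smooth_line[g1 g2].
have lin (a b : R) (p q h : R -> R) r : smooth1 p -> smooth1 q -> smooth1 h ->
    quot (oddp (fun r => a * p r + b * q r + h r)) r =
    a * quot (oddp p) r + b * quot (oddp q) r + quot (oddp h) r.
  move=> sp sq sh; rewrite /quot; case: eqP => r0; last by rewrite /oddp; ring.
  have d u : smooth1 u -> is_derive (0 : R) 1 (oddp u) (derive1 (oddp u) 0).
    by move=> su; exact: (smooth1_is_derive 0 0 (derive1n_oddp su).1).
  have H := is_deriveD (is_deriveD (is_deriveZ a (d _ sp)) (is_deriveZ b (d _ sq))) (d _ sh).
  have H' := @is_derive_ext _ _ _ _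
    (oddp (fun r => a * p r + b * q r + h r)) _ _ _ _ _ H erefl.
  rewrite derive1E; apply: (@derive_val _ _ _ _ _ _ _ (H' _)) => s.
  change (a * oddp p s + b * oddp q s + oddp h s =
    oddp (fun r => a * p r + b * q r + h r) s).
  by rewrite /oddp; ring.
apply/funext => x; case: c => a b; rewrite /radial_quotient.
have -> : (fun r => complex.Re ((a +i* b) * f r + g r)) = (fun r =>
    a * complex.Re (f r) + - b * complex.Im (f r) + complex.Re (g r)).
  by apply/funext => r; case: (f r) (g r) => [u w] [u' w'] /=; ring.
have -> : (fun r => complex.Im ((a +i* b) * f r + g r)) = (fun r =>
    a * complex.Im (f r) + b * complex.Re (f r) + complex.Im (g r)).
  by apply/funext => r; case: (f r) (g r) => [u w] [u' w'] /=; ring.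
rewrite !lin//; apply/eqP; rewrite eq_complex /=; apply/andP; split; apply/eqP; ring.
Qed.

(** The map [radial_quotient] is continuous between the Schwartz spaces, so that
    tempered functionals pull back to tempered functionals. *)
Lemma radial_pullback_continuous (T : ('rV[R]_k -> R[i]) -> R[i]) :
  schwartz_continuous_linear T ->
  schwartz_continuous_linear (fun f => T (radial_quotient f)).
Proof.
move=> [lT [C [s hC]]]; split=> [c f g sf sg|].
  rewrite (radial_quotient_lin c sf.1 sg.1).
  by apply: lT; exact: schwartz_radial_quotient.
have [C' [s' [C'0 h]]] := seminorm_radial_quotient s.
exists (`|C| * C'), s' => f sf; rewrite -mulrA.
apply: le_trans (hC _ (schwartz_radial_quotient sf)) _.
apply: le_trans (ler_wpM2l _ (h f sf)) => //.
rewrite ler_wpM2r ?ler_norm// sumr_ge0// => i _.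
exact/seminorm_ge0/schwartz_radial_quotient.
Qed.

Lemma closed_enorm_le (B : R) : closed [set x : 'rV[R]_k | enorm x <= B].
Proof.
have /continuous_closedP ce := @continuous_enorm R k.
exact: (ce _ (@closed_le R B)).
Qed.

Lemma test_function_bounded_support (g : 'rV[R]_k -> R[i]) (B : R) : smooth g ->
  (forall x, B < enorm x -> g x = 0) -> test_function g.
Proof.
move=> sg g0; split=> //; apply: bounded_closed_compact; last exact: closed_closure.
have sub : fsupport g `<=` [set x : 'rV[R]_k | enorm x <= B].
  apply: fsupport_sub; first exact: closed_enorm_le.
  by move=> x gx /=; rewrite leNgt; apply: contra gx => /g0 ->.
exists B; split; first exact: num_real.
move=> M BM x /sub /= xB; apply: le_trans (ltW BM).
exact: le_trans (norm_le_enorm x) xB.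
Qed.

Lemma test_function_line f : test_function f ->
  exists2 B : R, 0 < B & forall r, B <= `|r| -> f r = 0.
Proof.
move=> [_ kf]; have [B B0 hB] := compact_ubound kf (@norm_continuous R R).
exists (B + 1) => [|r rB]; first by rewrite ltr_wpDl.
apply/eqP; apply: contraT => fr; have := hB r (@subset_closure _ _ r fr).
by rewrite normr_id; lra.
Qed.

Lemma test_function_radial_quotient f : test_function f ->
  test_function (radial_quotient f).
Proof.
move=> tf; have [B B0 hB] := test_function_line tf.
apply: (@test_function_bounded_support _ B); first exact: smooth_radial_quotient tf.1.
move=> x xB; rewrite /radial_quotient /quot.
have x0 : enorm x != 0 by rewrite gt_eqF// (lt_trans B0).
rewrite (negbTE x0) /oddp !hB ?normrN ?ger0_norm ?enorm_ge0 ?ltW//=.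
by rewrite subrr mul0r.
Qed.

End RadialExtension.

(** * Shears and rotations preserve Lebesgue measure *)
Section LebesgueMeasureOnTuples.
Variable R : realType.
Local Notation mu := (@lebesgue_measure R).
Local Notation leb := (lebesgue_tuple R).
Local Notation tup n := (n.-tuple (measurableTypeR R)).
Local Open Scope ereal_scope.

Lemma ge0_integral_cons n (f : tup n.+1 -> \bar R) :
  measurable_fun setT f -> (forall t, 0 <= f t) ->
  \int[leb n.+1]_t f t = \int[mu \x leb n]_p f (cons_pair p).
Proof.
move=> mf f0.
have mc := @measurable_cons_pair _ (measurableTypeR R) n.
have := @ge0_integral_pushforward _ _ _ _ R _ mc (mu \x leb n) setT f measurableT.
by rewrite preimage_setT; apply => // t _; exact: f0.
Qed.

Lemma ge0_integral_cons1 n (f : tup n.+1 -> \bar R) :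
  measurable_fun setT f -> (forall t, 0 <= f t) ->
  \int[leb n.+1]_t f t = \int[mu]_x \int[leb n]_t f (cons_pair (x, t)).
Proof.
move=> mf f0; rewrite ge0_integral_cons//.
rewrite (@fubini_tonelli1 _ _ _ _ R mu (leb n) (f \o @cons_pair _ n))//.
  by apply: measurableT_comp => //; exact: measurable_cons_pair.
by move=> p; exact: f0.
Qed.

Lemma ge0_integral_cons2 n (f : tup n.+1 -> \bar R) :
  measurable_fun setT f -> (forall t, 0 <= f t) ->
  \int[leb n.+1]_t f t = \int[leb n]_t \int[mu]_x f (cons_pair (x, t)).
Proof.
move=> mf f0; rewrite ge0_integral_cons1//.
rewrite (@fubini_tonelli _ _ _ _ R mu (leb n) (f \o @cons_pair _ n))//.
  by apply: measurableT_comp => //; exact: measurable_cons_pair.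
by move=> p; exact: f0.
Qed.

Lemma ge0_integral_translation (c : R) (f : measurableTypeR R -> \bar R) :
  measurable_fun setT f -> (forall t, 0 <= f t) ->
  \int[mu]_x f (x + c)%R = \int[mu]_x f x.
Proof.
move=> mf f0.
have mc : measurable_fun setT (fun x : measurableTypeR R => (x + c)%R : measurableTypeR R).
  by apply: measurable_funD => //; exact: measurable_cst.
have := @ge0_integral_pushforward _ _ _ _ R _ mc mu setT f measurableT mf
  (fun t _ => f0 t).
rewrite preimage_setT => <-; apply: eq_measure_integral => A mA _.
apply/esym/lebesgue_measure_unique => //= _ [[a b]] _ <-.
rewrite /pushforward.
have -> : (fun x : R => (x + c)%R) @^-1` `]a, b] = `](a - c)%R, (b - c)%R]%classic.
  by apply/seteqP; split=> x /=; rewrite !in_itv /= ltrBlDr lerBrDr.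
rewrite !lebesgue_measure_itv /= !lte_fin ltrD2r.
by case: ifP => // _; rewrite -!EFinB; congr EFin; ring.
Qed.

Definition tuple_add n (t u : tup n) : tup n :=
  [tuple (tnth t i + tnth u i)%R | i < n].

Lemma measurable_tuple_add d (T : measurableType d) n (t u : T -> tup n) :
  measurable_fun setT t -> measurable_fun setT u ->
  measurable_fun setT (fun x => tuple_add (t x) (u x)).
Proof.
move=> mt mu; apply/measurable_fun_tnthP => i.
rewrite (_ : _ \o _ = fun x => (tnth (t x) i + tnth (u x) i)%R).
  apply: measurable_funD.
    exact: (measurableT_comp (@measurable_tnth _ (measurableTypeR R) n i) mt).
  exact: (measurableT_comp (@measurable_tnth _ (measurableTypeR R) n i) mu).
by apply/funext => x /=; rewrite tnth_mktuple.
Qed.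

Lemma tuple_add_cons n (x y : R) (t u : tup n) :
  tuple_add (cons_pair (x, t)) (cons_pair (y, u)) =
  cons_pair ((x + y)%R, tuple_add t u).
Proof.
apply: eq_from_tnth => i; rewrite tnth_mktuple.
case: (unliftP ord0 i) => [j ->|->]; last by rewrite !tnth0.
by rewrite !tnthS tnth_mktuple.
Qed.

Lemma cons_pairP n (t : tup n.+1) : exists x u, t = cons_pair (x, u).
Proof.
by exists (thead t), [tuple of behead t]; rewrite [LHS]tuple_eta; exact: val_inj.
Qed.

Lemma ge0_integral_tuple_translation n (v : tup n) (f : tup n -> \bar R) :
  measurable_fun setT f -> (forall t, 0 <= f t) ->
  \int[leb n]_t f (tuple_add t v) = \int[leb n]_t f t.
Proof.
elim: n v f => [|n IH] v f mf f0.
  by apply: eq_integral => t _; rewrite (tuple0 t) (tuple0 (tuple_add _ _)).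
have madd m (u : tup m) : measurable_fun setT (fun t => tuple_add t u).
  by apply: measurable_tuple_add => //; exact: measurable_cst.
have [y [u vE]] := cons_pairP v.
have mfv : measurable_fun setT (fun t => f (tuple_add t v)) :=
  measurableT_comp mf (madd _ v).
rewrite (ge0_integral_cons1 mfv (fun t => f0 _)) (ge0_integral_cons1 mf f0).
have mfx x : measurable_fun setT (fun t : tup n => f (cons_pair (x, t))).
  by apply: measurableT_comp => //; apply: measurableT_comp => //; exact: measurable_cons_pair.
rewrite -(@ge0_integral_translation y (fun x => \int[leb n]_t f (cons_pair (x, t)))).
- apply: eq_integral => x _.
  rewrite -(IH u (fun t => f (cons_pair ((x + y)%R, t))))//.
  by apply: eq_integral => t _; rewrite vE tuple_add_cons.
- apply: (@measurable_fun_fubini_tonelli_F _ _ _ _ R (leb n) (f \o @cons_pair _ n)).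
    by apply: measurableT_comp => //; exact: measurable_cons_pair.
  by move=> p; exact: f0.
by move=> x; apply: integral_ge0 => t _; exact: f0.
Qed.

(** Stated for integrals of nonnegative functions rather than for measures of sets:
    this is the form in which it composes and in which it is used. *)
Definition measure_preserving n (phi : tup n -> tup n) : Prop :=
  measurable_fun setT phi /\ forall f : tup n -> \bar R,
    measurable_fun setT f -> (forall t, 0 <= f t) ->
    \int[leb n]_t f (phi t) = \int[leb n]_t f t.

Lemma measure_preserving_comp n (phi psi : tup n -> tup n) :
  measure_preserving phi -> measure_preserving psi ->
  measure_preserving (phi \o psi).
Proof.
move=> [m1 h1] [m2 h2]; split=> [|f mf f0]; first exact: measurableT_comp.
rewrite -[RHS]h1// -[RHS]h2//; exact: measurableT_comp.
Qed.

Lemma measure_preserving_integral n (phi : tup n -> tup n) (f : tup n -> \bar R) :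
  measure_preserving phi -> measurable_fun setT f ->
  \int[leb n]_t f (phi t) = \int[leb n]_t f t.
Proof.
move=> [mphi h] mf; rewrite [LHS]integralE [RHS]integralE; congr (_ - _).
  apply: etrans (h f^\+ _ _).
  - by apply: eq_integral => t _; rewrite (funepos_comp f phi).
  - exact: measurable_funepos.
  - by move=> t; exact: funepos_ge0.
apply: etrans (h f^\- _ _).
- by apply: eq_integral => t _; rewrite (funeneg_comp f phi).
- exact: measurable_funeneg.
- by move=> t; exact: funeneg_ge0.
Qed.

Lemma measurable_thead n :
  measurable_fun setT (fun t : tup n.+1 => thead t : measurableTypeR R).
Proof. exact: measurable_tnth. Qed.

Lemma measurable_tbehead n :
  measurable_fun setT (fun t : tup n.+1 => [tuple of behead t] : tup n).
Proof. exact: measurable_behead. Qed.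

Lemma measurable_consl n (t : tup n) :
  measurable_fun setT (fun x : measurableTypeR R => cons_pair (x, t)).
Proof.
apply: (@measurable_cons _ _ (measurableTypeR R) (measurableTypeR R)
  (fun x => x) n (fun=> t)); first exact: measurable_id.
exact: measurable_cst.
Qed.

Lemma measurable_consr n (x : measurableTypeR R) :
  measurable_fun setT (fun t : tup n => cons_pair (x, t)).
Proof.
apply: (@measurable_cons _ _ (tup n) (measurableTypeR R)
  (fun=> x) n (fun t => t)); first exact: measurable_cst.
exact: measurable_id.
Qed.

Lemma thead_cons n (x : R) (t : tup n) : thead (cons_pair (x, t)) = x.
Proof. by []. Qed.

Lemma tbehead_cons n (x : R) (t : tup n) :
  [tuple of behead (cons_pair (x, t))] = t.
Proof. exact: val_inj. Qed.

(** The shear translates the first coordinate by an amount that depends only on the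
    others. *)
Lemma measure_preserving_shear1 n (L : tup n -> R) : measurable_fun setT L ->
  measure_preserving (fun t : tup n.+1 =>
    cons_pair ((thead t + L [tuple of behead t])%R, [tuple of behead t])).
Proof.
move=> mL; split=> [|f mf f0]; [apply: measurable_cons|].
- apply: measurable_funD; first exact: measurable_thead.
  exact: (measurableT_comp mL (@measurable_tbehead n)).
- exact: measurable_tbehead.
have mg : measurable_fun setT (fun t : tup n.+1 =>
    cons_pair ((thead t + L [tuple of behead t])%R, [tuple of behead t])).
  apply: measurable_cons; last exact: measurable_tbehead.
  apply: measurable_funD; first exact: measurable_thead.
  exact: (measurableT_comp mL (@measurable_tbehead n)).
rewrite (ge0_integral_cons2 (measurableT_comp mf mg) (fun t => f0 _)).
rewrite (ge0_integral_cons2 mf f0); apply: eq_integral => t _.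
rewrite -(@ge0_integral_translation (L t) (fun x => f (cons_pair (x, t))))//.
  by apply: eq_integral => x _; rewrite /= thead_cons tbehead_cons.
exact: (measurableT_comp mf (measurable_consl t)).
Qed.

Definition tuple_scale n (c : R) (t : tup n) : tup n :=
  [tuple (c * tnth t i)%R | i < n].

Lemma measurable_tuple_scale d (T : measurableType d) n (c : T -> R) (v : tup n) :
  measurable_fun setT c -> measurable_fun setT (fun x => tuple_scale (c x) v).
Proof.
move=> mc; apply/measurable_fun_tnthP => i.
rewrite (_ : _ \o _ = fun x => (c x * tnth v i)%R).
  by apply: measurable_funM => //; exact: measurable_cst.
by apply/funext => x /=; rewrite tnth_mktuple.
Qed.

(** The shear translates the last coordinates by an amount that depends only on the
    first. *)
Lemma measure_preserving_shear2 n (v : tup n) (c : R) :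
  measure_preserving (fun t : tup n.+1 =>
    cons_pair (thead t, tuple_add [tuple of behead t] (tuple_scale (c * thead t)%R v))).
Proof.
have mg : measurable_fun setT (fun t : tup n.+1 =>
    cons_pair (thead t, tuple_add [tuple of behead t] (tuple_scale (c * thead t)%R v))).
  apply: measurable_cons; first exact: measurable_thead.
  apply: measurable_tuple_add; first exact: measurable_tbehead.
  apply: measurable_tuple_scale; apply: measurable_funM; first exact: measurable_cst.
  exact: measurable_thead.
split=> // f mf f0.
rewrite (ge0_integral_cons1 (measurableT_comp mf mg) (fun t => f0 _)).
rewrite (ge0_integral_cons1 mf f0); apply: eq_integral => x _.
rewrite -(@ge0_integral_tuple_translation n (tuple_scale (c * x) v)
  (fun t => f (cons_pair (x, t)))) => [| |t]; [|..|exact: f0].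
- by apply: eq_integral => t _; rewrite /= thead_cons tbehead_cons.
- exact: (measurableT_comp mf (measurable_consr x)).
Qed.

Local Close Scope ereal_scope.

Definition tuple_dot n (t u : tup n) : R := \sum_(i < n) tnth t i * tnth u i.

Lemma measurable_tuple_dot n (u : tup n) :
  measurable_fun setT (fun t : tup n => tuple_dot u t).
Proof.
apply: measurable_sum => i; apply: measurable_funM; first exact: measurable_cst.
exact: (@measurable_tnth _ (measurableTypeR R) n i).
Qed.

Lemma measurable_tuple_sqr n : measurable_fun setT (fun t : tup n => tuple_dot t t).
Proof.
apply: measurable_sum => i; apply: measurable_funM;
  exact: (@measurable_tnth _ (measurableTypeR R) n i).
Qed.

Lemma tuple_dot_cons n (x y : R) (t u : tup n) :
  tuple_dot (cons_pair (x, t)) (cons_pair (y, u)) = x * y + tuple_dot t u.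
Proof.
rewrite /tuple_dot big_ord_recl !tnth0; congr (_ + _).
by apply: eq_bigr => i _; rewrite !tnthS.
Qed.

Lemma tuple_dotC n (t u : tup n) : tuple_dot t u = tuple_dot u t.
Proof. by apply: eq_bigr => i _; rewrite mulrC. Qed.

Lemma tuple_dot_add n (t u w : tup n) :
  tuple_dot w (tuple_add t u) = tuple_dot w t + tuple_dot w u.
Proof.
by rewrite /tuple_dot -big_split; apply: eq_bigr => i _; rewrite tnth_mktuple mulrDr.
Qed.

Lemma tuple_dot_scale n (c : R) (t w : tup n) :
  tuple_dot w (tuple_scale c t) = c * tuple_dot w t.
Proof.
by rewrite /tuple_dot mulr_sumr; apply: eq_bigr => i _; rewrite tnth_mktuple mulrCA.
Qed.

Lemma tuple_dot_ge0 n (t : tup n) : 0 <= tuple_dot t t.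
Proof. by apply: sumr_ge0 => i _; rewrite -expr2 sqr_ge0. Qed.

(** Any direction is carried to the first axis by a rotation of the plane that
    they span; such a rotation is a product of three shears. *)
Lemma rotation_to_first_axis n (xi : tup n.+1) : exists (rho : R) (phi : tup n.+1 -> tup n.+1),
  [/\ rho ^+ 2 = tuple_dot xi xi, measure_preserving phi,
      forall t, tuple_dot (phi t) (phi t) = tuple_dot t t &
      forall t, tuple_dot xi (phi t) = rho * thead t].
Proof.
have [x0 [eta ->]] := cons_pairP xi; rewrite tuple_dot_cons.
set q := tuple_dot eta eta; have q0 : 0 <= q by exact: tuple_dot_ge0.
have [qE|qN0] := eqVneq q 0.
  exists x0, id; split=> //; first by rewrite qE addr0.
  move=> t; have [y [u ->]] := cons_pairP t.
  rewrite tuple_dot_cons thead_cons [X in _ + X]big1 ?addr0// => i _.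
  move/eqP: qE; rewrite /q psumr_eq0 => [/allP h|j _]; last by rewrite -expr2 sqr_ge0.
  have := h i (mem_index_enum _); rewrite -expr2 sqrf_eq0 => /eqP ->.
  by rewrite mul0r.
pose r := Num.sqrt (x0 * x0 + q).
have rr : r ^+ 2 = x0 * x0 + q.
  by rewrite sqr_sqrtr// addr_ge0// -expr2 sqr_ge0.
have r0 : r != 0.
  by rewrite -sqrf_eq0 rr gt_eqF// ltr_wpDl ?lt_neqAle 1?eq_sym ?qN0 ?q0// -expr2 sqr_ge0.
have qr : q = r ^+ 2 - x0 ^+ 2 by rewrite rr expr2 addrAC subrr add0r.
(* The rotation has angle [th] with [cos th = x0/r] and [sin th = sqrt q/r]; in the
   plane of the first axis and [eta / sqrt q] the three shears have coefficients
   [- tan (th/2) = - a * sqrt q], [sin th] and [- tan (th/2)] *)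
pose a := (r - x0) / q.
pose S1 (t : tup n.+1) := cons_pair
  (thead t + (- a) * tuple_dot eta [tuple of behead t], [tuple of behead t]) : tup n.+1.
pose S2 (t : tup n.+1) := cons_pair (thead t,
  tuple_add [tuple of behead t] (tuple_scale (r^-1 * thead t) eta)) : tup n.+1.
have mS1 : measure_preserving S1.
  apply: (@measure_preserving_shear1 n (fun t => - a * tuple_dot eta t)).
  apply: measurable_funM; [exact: measurable_cst|exact: measurable_tuple_dot].
have mS2 : measure_preserving S2 := measure_preserving_shear2 eta r^-1.
exists r, (S1 \o (S2 \o S1)); split=> //.
- exact/measure_preserving_comp/measure_preserving_comp.
- move=> t; have [y [u ->]] := cons_pairP t.
  rewrite /= /S1 /S2 !(thead_cons, tbehead_cons) !tuple_dot_cons.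
  rewrite !(tuple_dot_add, tuple_dot_scale).
  rewrite (tuple_dotC (tuple_add _ _) u) (tuple_dotC (tuple_add _ _) eta).
  rewrite !(tuple_dot_add, tuple_dot_scale) -/q (tuple_dotC u eta).
  set d := tuple_dot eta u; set w := tuple_dot u u.
  by rewrite /a qr; field; rewrite -qr qN0 r0.
move=> t; have [y [u ->]] := cons_pairP t.
rewrite /= /S1 /S2 !(thead_cons, tbehead_cons) !tuple_dot_cons.
rewrite !(tuple_dot_add, tuple_dot_scale) -/q.
set d := tuple_dot eta u.
by rewrite /a qr; field; rewrite -qr qN0 r0.
Qed.

Local Open Scope ereal_scope.

Lemma integral_cons n (f : tup n.+1 -> \bar R) :
  (leb n.+1).-integrable setT f ->
  \int[leb n.+1]_t f t = \int[mu]_x \int[leb n]_t f (cons_pair (x, t)).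
Proof.
move=> intf; have /integrableP[mf foo] := intf.
have mc := @measurable_cons_pair _ (measurableTypeR R) n.
have mfc := measurableT_comp mf mc.
have intg : (mu \x leb n).-integrable setT (f \o @cons_pair _ n).
  apply/integrableP; split=> //.
  have mfa : measurable_fun setT (fun t => `|f t|) by exact: measurableT_comp.
  by rewrite -(ge0_integral_cons mfa).
have := @integral_pushforward _ _ _ _ R _ mc (mu \x leb n) setT f mf intg measurableT.
by rewrite preimage_setT => ->; rewrite -integral12_prod_meas1.
Qed.

Definition tuple_box (b : R) n : set (tup n) :=
  [set t | forall i, (`|tnth t i| <= b)%R].
Arguments tuple_box : clear implicits.

Lemma measurable_tuple_box b n : measurable (tuple_box b n).
Proof.
rewrite (_ : tuple_box b n = \bigcap_(i in [set: 'I_n]) [set t : tup n | (`|tnth t i| <= b)%R]).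
  apply: fin_bigcap_measurable => // i _.
  have mi : measurable_fun setT (fun t : tup n => `|tnth t i|%R).
    by apply: measurableT_comp => //; exact: (@measurable_tnth _ (measurableTypeR R) n i).
  rewrite (_ : [set t : tup n | _] = (fun t : tup n => `|tnth t i|%R) @^-1` `]-oo, b]%classic).
    by rewrite -[X in measurable X]setTI; exact: mi.
  by apply/seteqP; split=> t /=; rewrite in_itv.
by apply/seteqP; split=> t h i => [_|]; exact: h.
Qed.

Lemma lebesgue_tuple_box_lty b n : leb n (tuple_box b n) < +oo.
Proof.
elim: n => [|n IH].
  by rewrite /= /dirac indicE; case: (_ \in _); rewrite ltry.
have -> : leb n.+1 (tuple_box b n.+1) = (mu \x leb n) (`[(- b)%R, b]%classic `*` tuple_box b n).
  rewrite [LHS]/= /cons_measure /pushforward; congr (_ _).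
  apply/seteqP; split=> [[x t] h|[x t] [/= hx ht] i]; [split=> /=|].
  - by have := h ord0; rewrite tnth0 ler_norml in_itv.
  - by move=> i; have := h (lift ord0 i); rewrite tnthS.
  - case: (unliftP ord0 i) => [j ->|->]; first by rewrite tnthS.
    by rewrite tnth0 ler_norml; move: hx; rewrite in_itv.
rewrite product_measure1E//; last exact: measurable_tuple_box.
rewrite lte_mul_pinfty//= lebesgue_measure_itv /= lte_fin; case: ifP => // _.
Qed.

Lemma integrable_bounded_support n (f : tup n -> R) (M B : R) :
  measurable_fun setT f -> (forall t, (`|f t| <= M)%R) ->
  (forall t, (B < tuple_dot t t)%R -> f t = 0%R) ->
  (leb n).-integrable setT (EFin \o f).
Proof.
move=> mf fM f0; pose b : R := (`|B| + 1)%R.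
have mb := @measurable_tuple_box b n.
have supp t : ~ tuple_box b n t -> f t = 0%R.
  move=> /existsNP[i /negP]; rewrite -ltNge => bi; apply: f0.
  have b1 : (1 <= b)%R by rewrite lerDr.
  apply: (@lt_le_trans _ _ (b ^+ 2)%R).
    by rewrite (@lt_le_trans _ _ b) ?ltr_pwDr ?ler_norm// expr2 ler_peMl// (le_trans ler01).
  apply: (@le_trans _ _ (tnth t i ^+ 2)%R).
    by rewrite -[leRHS]real_normK ?num_real// lerXn2r ?nnegrE ?(ltW bi)// (le_trans ler01).
  rewrite /tuple_dot (bigD1 i)//= -expr2 lerDl sumr_ge0// => j _.
  by rewrite -expr2 sqr_ge0.
have -> : EFin \o f = (EFin \o f) \_ (tuple_box b n).
  apply/funext => t; rewrite /patch; case: ifPn => // /negP.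
  by rewrite inE => /supp /= ->.
apply: (proj1 (integrable_mkcond _ mb)); apply: measurable_bounded_integrable => //.
- exact: lebesgue_tuple_box_lty.
- exact: measurable_funTS.
- by exists M; split; [exact: num_real|move=> x Mx t _ /=; exact: le_trans (ltW Mx)].
Qed.

(** * Polar coordinates of the plane *)

(** The slices of the disc have length [2 sqrt(c - x^2)]; the substitution
    [x = sqrt c * sin t] makes their integral elementary. *)
Lemma disc_area (c : R) : (0 <= c)%R ->
  (mu \x mu) [set p : measurableTypeR R * measurableTypeR R | (p.1 ^+ 2 + p.2 ^+ 2 <= c)%R] =
  (pi * c)%:E.
Proof.
move=> c0; pose g (x : R) : R := (2 * Num.sqrt (c - x ^+ 2))%R.
have -> : (mu \x mu) [set p : measurableTypeR R * measurableTypeR R | (p.1 ^+ 2 + p.2 ^+ 2 <= c)%R] =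
    \int[mu]_x (g x)%:E.
  rewrite /product_measure1; apply: eq_integral => x _ /=.
  rewrite (_ : xsection _ _ = if (x ^+ 2 <= c)%R
    then `[(- Num.sqrt (c - x ^+ 2))%R, Num.sqrt (c - x ^+ 2)]%classic else set0).
    rewrite /g; case: ifPn => [xc|]; last first.
      by rewrite -ltNge => cx; rewrite measure0 ler0_sqrtr ?mulr0// subr_le0 ltW.
    rewrite lebesgue_measure_itv /= lte_fin; case: ifPn => [_|].
      by rewrite -EFinB opprK; congr EFin; ring.
    rewrite -leNgt; have := sqrtr_ge0 (c - x ^+ 2); set s := Num.sqrt _ => s0 sN.
    have -> : s = 0%R by lra.
    by rewrite mulr0.
  apply/seteqP; split=> y; rewrite /xsection /= inE /=.
    move=> xy; have xc : (x ^+ 2 <= c)%R by rewrite (le_trans _ xy)// lerDl sqr_ge0.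
    rewrite xc /= in_itv /= -ler_norml -sqrtr_sqr ler_sqrt ?subr_ge0//.
    by rewrite lerBrDl.
  case: ifPn => //= xc; rewrite in_itv /= -ler_norml -sqrtr_sqr ler_sqrt ?subr_ge0//.
  by rewrite lerBrDl.
move: c0; rewrite le_eqVlt => /predU1P[c0|c0].
  rewrite -c0 mulr0; rewrite (eq_integral (cst 0)) ?integral0// => x _.
  by rewrite /g -c0 sub0r ler0_sqrtr ?mulr0// oppr_le0 sqr_ge0.
pose a := Num.sqrt c.
have a0 : (0 < a)%R by rewrite sqrtr_gt0.
have aa : (a ^+ 2)%R = c by rewrite sqr_sqrtr// ltW.
have -> : \int[mu]_x (g x)%:E = \int[mu]_(x in `[(- a)%R, a]) (g x)%:E.
  rewrite [RHS]integral_mkcond; apply: eq_integral => x _; rewrite /patch.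
  case: ifPn => // /negP; rewrite inE /= in_itv /= -ler_norml => /negP; rewrite -ltNge => ax.
  rewrite /g ler0_sqrtr ?mulr0// subr_le0 -aa -[leRHS]real_normK ?num_real//.
  by rewrite lerXn2r ?nnegrE ?normr_ge0 ?(ltW ax) ?(ltW a0).
pose F (t : R) : R := (a * sin t)%R.
have pi20 : (0 < pi / 2 :> R)%R by rewrite divr_gt0// pi_gt0.
have dF : derive1 F = (fun t => a * cos t)%R.
  apply/funext => t; rewrite derive1E.
  by have h := is_deriveZ a (is_derive_sin t); rewrite (@derive_val _ _ _ _ _ _ _ h).
have dvF t : derivable F t 1%R.
  by have [] := is_deriveZ a (is_derive_sin t).
have Fpi : F (pi / 2)%R = a by rewrite /F sin_pihalf mulr1.
have FNpi : F (- (pi / 2))%R = (- a)%R by rewrite /F sinN sin_pihalf mulrN1.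
have cg : continuous g.
  move=> x; apply: cvgM; first exact: cvg_cst.
  apply: (continuous_comp (f := fun x : R => (c - x ^+ 2)%R)); last exact: sqrt_continuous.
  by apply: cvgB; [exact: cvg_cst|exact: exprn_continuous].
have cF' : continuous (fun t => a * cos t)%R.
  by move=> t; apply: cvgM; [exact: cvg_cst|exact: continuous_cos].
have cF : continuous F.
  by move=> t; apply: cvgM; [exact: cvg_cst|exact: continuous_sin].
transitivity (\int[mu]_(x in `[F (- (pi / 2))%R, F (pi / 2)%R]) (g x)%:E).
  by rewrite FNpi Fpi.
rewrite (@integration_by_substitution_increasing _ F g); first last.
- exact: continuous_subspaceT.
- split=> [t _||].
  + exact: dvF.
  + exact/cvg_at_right_filter/cF.
  + exact/cvg_at_left_filter/cF.
- by rewrite dF; apply/cvg_ex; eexists; exact/cvg_at_left_filter/cF'.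
- by rewrite dF; apply/cvg_ex; eexists; exact/cvg_at_right_filter/cF'.
- by rewrite dF => t _; exact: cF'.
- by move=> x y xI yI xy; rewrite /F ltr_pM2l// ltr_sin.
- by lra.
pose P (t : R) : R := (c * (t + sin t * cos t))%R.
have dP (t : R) : is_derive t (1 : R)%R P (c * (2 * cos t ^+ 2))%R.
  apply: (is_derive_ext _ (is_deriveZ c (is_deriveD (is_derive_id t (1 : R)%R)
    (is_deriveM (is_derive_sin t) (is_derive_cos t))))) => //.
  rewrite /GRing.scale /=; congr (_ * _)%R.
  by have := cos2Dsin2 t; rewrite -!expr2 mulrN => h; lra.
have cP : continuous P.
  move=> t; apply/differentiable_continuous/derivable1_diffP.
  by have [] := dP t.
transitivity (\int[mu]_(t in `[(- (pi / 2))%R, (pi / 2)%R])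
    (c * (2 * cos t ^+ 2))%:E).
  apply: eq_integral => t; rewrite inE /= in_itv /= => /andP[t1 t2]; congr EFin.
  rewrite fctE dF /g /F /=.
  have -> : (c - (a * sin t) ^+ 2 = (a * cos t) ^+ 2)%R.
    by rewrite !exprMn aa -[X in (X - _)%R]mulr1 -(cos2Dsin2 t); ring.
  rewrite sqrtr_sqr ger0_norm; last by rewrite mulr_ge0 ?cos_ge0_pihalf ?t1// ltW.
  by rewrite -aa; ring.
rewrite (@continuous_FTC2 _ _ P); first last.
- by move=> t _; rewrite derive1E; exact: (@derive_val _ _ _ _ _ _ _ (dP t)).
- split=> [t _||].
  + by have [] := dP t.
  + exact/cvg_at_right_filter/cP.
  + exact/cvg_at_left_filter/cP.
- apply: continuous_subspaceT => t; apply: cvgM; first exact: cvg_cst.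
  apply: cvgM; first exact: cvg_cst.
  exact: (cvgM (@continuous_cos R t) (@continuous_cos R t)).
- by lra.
rewrite -EFinB; congr EFin; rewrite /P sinN cosN sin_pihalf cos_pihalf.
by field.
Qed.

Definition sum_sqr (p : measurableTypeR R * measurableTypeR R) : measurableTypeR R :=
  (p.1 ^+ 2 + p.2 ^+ 2)%R.

Lemma measurable_sum_sqr : measurable_fun setT sum_sqr.
Proof.
by apply: measurable_funD; apply: measurable_funX;
  [exact: measurable_fst|exact: measurable_snd].
Qed.

HB.instance Definition _ := isMeasurableFun.Build _ _ _ _ sum_sqr measurable_sum_sqr.

Let half_line : set (measurableTypeR R) := `[0%R, +oo[%classic.

Let measurable_half_line : measurable half_line.
Proof. exact: measurable_itv. Qed.

Lemma sum_sqr_ray (b : R) :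
  (mu \x mu) (sum_sqr @^-1` `]-oo, b]%classic) = (pi * Num.max b 0)%:E.
Proof.
have [b0|b0] := leP 0%R b.
  by rewrite -disc_area//; congr (_ _).
rewrite mulr0 (_ : _ @^-1` _ = set0) ?measure0//; apply/seteqP; split=> // p.
rewrite /sum_sqr /= in_itv /=; apply/negP; rewrite -ltNge (lt_le_trans b0)//.
by rewrite addr_ge0 ?sqr_ge0.
Qed.

Let scaled_half_line : {measure set (measurableTypeR R) -> \bar R} :=
  mscale (NngNum (pi_ge0 R)) (mrestr mu measurable_half_line).

Lemma sum_sqr_ocitv (a b : R) :
  (mu \x mu) (sum_sqr @^-1` `]a, b]%classic) = scaled_half_line `]a, b]%classic.
Proof.
have [ba|ab] := leP b a.
  by rewrite set_itv_ge ?bnd_simp -?leNgt// preimage_set0 !measure0.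
have mr c : measurable (sum_sqr @^-1` `]-oo, c]%classic).
  by rewrite -[X in measurable X]setTI; exact: measurable_sum_sqr.
rewrite (_ : sum_sqr @^-1` `]a, b]%classic = sum_sqr @^-1` `]-oo, b]%classic `\`
    sum_sqr @^-1` `]-oo, a]%classic); last first.
  apply/seteqP; split=> p /=; rewrite !in_itv /=.
    by move=> /andP[h1 ->]; split=> //; apply/negP; rewrite -ltNge.
  by move=> [-> /negP]; rewrite -ltNge => ->.
rewrite measureD//; last by rewrite [X in X < _](sum_sqr_ray b) ltry.
rewrite setIidr; last first.
  by move=> p /=; rewrite !in_itv /= => /le_trans; apply; exact: ltW.
rewrite [X in X - _](sum_sqr_ray b) [X in _ - X](sum_sqr_ray a) -EFinB -mulrBr EFinM.
transitivity (pi%:E * mu (`]a, b]%classic `&` half_line)); last by [].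
congr (_ * _).
have [a0|a0] := leP 0%R a.
  rewrite setIidl; last first.
    move=> u; rewrite /half_line /= !in_itv /= andbT => /andP[au _].
    by rewrite (le_trans a0)// ltW.
  by rewrite lebesgue_measure_itv /= lte_fin ab (max_l (le_trans a0 (ltW ab))) EFinB.
rewrite (_ : _ `&` _ = `[0%R, b]%classic); last first.
  apply/seteqP; split=> u; rewrite /half_line /= !in_itv /= ?andbT.
    by move=> [/andP[_ ->] ->].
  by move=> /andP[u0 ->]; rewrite (lt_le_trans a0).
rewrite lebesgue_measure_itv /= lte_fin subr0.
case: ifPn => [b0|].
  by rewrite oppr0 adde0 max_l// ltW.
by rewrite -leNgt => b0; rewrite max_r.
Qed.

(** The disc of squared radius [c] has area [pi c]: under the planar measure the
    squared norm is distributed like [pi] times the Lebesgue measure of the half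
    line. *)
Lemma pushforward_sum_sqr (A : set (measurableTypeR R)) : measurable A ->
  (mu \x mu) (sum_sqr @^-1` A) = scaled_half_line A.
Proof.
move=> mA.
have cover : \bigcup_n `](- n%:R)%R, n%:R]%classic = [set: measurableTypeR R].
  apply/seteqP; split=> // x _; exists (Num.bound `|x|%R) => //=.
  have := archi_boundP (normr_ge0 x); rewrite ltr_norml in_itv /=.
  by move=> /andP[-> /ltW].
have mG : @ocitv R `<=` @measurable _ (measurableTypeR R).
  by move=> _ [[a b] _ <-]; exact: measurable_itv.
have Gg n : @ocitv R `](- n%:R)%R, n%:R]%classic by exact: is_ocitv.
have agree B : @ocitv R B -> pushforward (mu \x mu) sum_sqr B = scaled_half_line B.
  by move=> [[a b] _ <-]; exact: sum_sqr_ocitv.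
have fin n : pushforward (mu \x mu) sum_sqr `](- n%:R)%R, n%:R]%classic < +oo.
  apply: (@le_lt_trans _ _ (pi * Num.max n%:R 0)%:E); last exact: ltry.
  rewrite -sum_sqr_ray /pushforward; apply: le_measure; rewrite ?inE.
  - by rewrite -[X in measurable X]setTI; exact: measurable_sum_sqr.
  - by rewrite -[X in measurable X]setTI; exact: measurable_sum_sqr.
  - by move=> p /=; rewrite !in_itv /= => /andP[].
exact: (@g_sigma_algebra_measure_unique _ R (measurableTypeR R) (@ocitv R) mG _ Gg cover
  (pushforward (mu \x mu) sum_sqr) scaled_half_line (@ocitvI R) agree fin A mA).
Qed.

Lemma ge0_integral_polar (f : measurableTypeR R -> \bar R) :
  measurable_fun setT f -> (forall u, 0 <= f u) ->
  \int[mu \x mu]_p f (sum_sqr p) = pi%:E * \int[mu]_(u in half_line) f u.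
Proof.
move=> mf f0.
have mfD : measurable_fun half_line f by exact: measurable_funTS.
have := @ge0_integral_pushforward _ _ _ _ R _ measurable_sum_sqr (mu \x mu) half_line f
  measurable_half_line mfD (fun t _ => f0 t).
rewrite (_ : sum_sqr @^-1` half_line = setT); last first.
  apply/seteqP; split=> // p _; rewrite /half_line /= in_itv /= andbT.
  by rewrite addr_ge0 ?sqr_ge0.
move=> <-; rewrite -(@ge0_integral_mscale _ _ _ mu half_line measurable_half_line
  (NngNum (pi_ge0 R)) f mfD (fun t _ => f0 t)).
apply: eq_measure_integral => A mA AD.
rewrite [LHS](pushforward_sum_sqr mA).
transitivity (pi%:E * mu (A `&` half_line)); first by [].
by rewrite setIidl.
Qed.

Lemma integral_polar (f : R -> R) : mu.-integrable half_line (EFin \o f) ->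
  measurable_fun setT f ->
  (mu \x mu).-integrable setT (fun p => (f (sum_sqr p))%:E) /\
  \int[mu \x mu]_p (f (sum_sqr p))%:E = pi%:E * \int[mu]_(u in half_line) (f u)%:E.
Proof.
move=> intf mf; pose F : measurableTypeR R -> \bar R := EFin \o f.
have mF : measurable_fun setT F by exact/measurable_EFinP.
have polar G : measurable_fun setT G -> (forall u, 0 <= G u) ->
    \int[mu \x mu]_p G (sum_sqr p) = pi%:E * \int[mu]_(u in half_line) G u.
  exact: ge0_integral_polar.
split.
  apply/integrableP; split; first exact: (measurableT_comp mF measurable_sum_sqr).
  rewrite (polar (abse \o F)); last first.
  - by move=> u; exact: abse_ge0.
  - exact: measurableT_comp.
  by apply: lte_mul_pinfty; rewrite ?lee_fin ?pi_ge0//; have /integrableP[] := intf.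
rewrite [LHS]integralE [in RHS]integralE muleBr//; last first.
  by rewrite fin_num_adde_defr//; exact: integrable_pos_fin_num intf.
congr (_ - _).
  apply: etrans (polar F^\+ _ _).
  - by apply: eq_integral => p _; rewrite (funepos_comp F sum_sqr).
  - exact: measurable_funepos.
  - by move=> u; exact: funepos_ge0.
apply: etrans (polar F^\- _ _).
- by apply: eq_integral => p _; rewrite (funeneg_comp F sum_sqr).
- exact: measurable_funeneg.
- by move=> u; exact: funeneg_ge0.
Qed.

Local Close Scope ereal_scope.

(** * Fourier transform of radial functions in odd dimension *)
Definition vanish_beyond (B : R) (h : R -> R) := forall r, B < `|r| -> h r = 0.

Lemma vanish_rderive B e : 0 <= B -> vanish_beyond B e -> vanish_beyond B (rderive e).
Proof.
move=> B0 eB r Br; have r0 : r != 0 by rewrite -normr_gt0 (le_lt_trans B0).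
rewrite /rderive /quot (negbTE r0) derive1E (@near_eq_derive _ _ _ _ (cst 0)).
  by rewrite derive_cst mul0r.
have oB : open [set x : R | B < `|x|].
  have /continuousP no := @norm_continuous R R.
  exact: (no _ (@open_gt R B)).
by apply: filterS (open_nbhs_nbhs (conj oB Br)) => x; exact: eB.
Qed.

Lemma vanish_iter_rderive B e j : 0 <= B -> vanish_beyond B e ->
  vanish_beyond B (iter j rderive e).
Proof. by move=> B0 eB; elim: j => //= j; exact: vanish_rderive. Qed.

Lemma vanish_bounded B h : continuous h -> vanish_beyond B h ->
  exists M, forall r, `|h r| <= M.
Proof.
move=> ch hB; have kB : compact `[(- B), B]%classic by exact: segment_compact.
have [M M0 hM] := @compact_ubound R R^o _ h kB ch; exists M => r.
have [rB|Br] := leP `|r| B; last by rewrite hB// normr0.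
by apply: hM; rewrite /= in_itv /= -ler_norml.
Qed.

Lemma smooth_even_continuous (e : R -> R) : smooth_even e -> continuous e.
Proof. by move=> [se _]; exact: (@smooth1_continuous R e 0 se). Qed.

(** Integration over planes inverts [rderive] up to a constant: as a function of
    [u = |y|^2] the integrand is the derivative of [2 c e(sqrt(s^2 + u))]. *)
Lemma integral_plane_rderive (c B s : R) e : smooth_even e -> 0 <= B ->
  vanish_beyond B e ->
  (\int[mu]_x \int[mu]_y (c * rderive e (Num.sqrt (s ^+ 2 + (x ^+ 2 + y ^+ 2))))%:E =
  (- (2 * pi) * c * e s)%:E)%E.
Proof.
move=> ee B0 eB.
have ed : smooth_even (rderive e) := smooth_even_iter_rderive 1 ee.
have vd := vanish_rderive B0 eB.
have cd := smooth_even_continuous ed; have ce := smooth_even_continuous ee.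
pose f (u : R) := c * rderive e (Num.sqrt (s ^+ 2 + u)).
(* the integrand vanishes for [u >= C] *)
pose C := B ^+ 2 + 1.
have C0 : 0 < C by rewrite ltr_wpDl// sqr_ge0.
have bigr u : C <= u -> B < `|Num.sqrt (s ^+ 2 + u)|.
  move=> Cu; rewrite ger0_norm ?sqrtr_ge0// -(ger0_norm B0) -sqrtr_sqr ltr_sqrt.
    by rewrite (@lt_le_trans _ _ C)// ?ltrDl// (le_trans Cu)// lerDr sqr_ge0.
  by rewrite ltr_wpDl ?sqr_ge0// (lt_le_trans C0).
have cs : continuous (fun u : R => Num.sqrt (s ^+ 2 + u)).
  move=> u; apply: (continuous_comp (f := fun u : R => s ^+ 2 + u)).
    by apply: cvgD; [exact: cvg_cst|exact: cvg_id].
  exact: sqrt_continuous.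
have cf : continuous f.
  move=> u; apply: cvgM; first exact: cvg_cst.
  by apply: (continuous_comp (f := fun u : R => Num.sqrt (s ^+ 2 + u)));
    [exact: cs|exact: cd].
have mf : measurable_fun setT f by exact: continuous_measurable_fun.
have fres : (EFin \o f) \_ `[0, C]%classic = (EFin \o f) \_ half_line.
  apply/funext => u; rewrite /patch /half_line; case: ifPn => [|/negP].
    by rewrite inE /= in_itv /= => /andP[u0 _]; rewrite mem_set//= in_itv /= u0.
  rewrite inE /= in_itv /= => /negP; rewrite negb_and -!ltNge => uC.
  case: ifPn => //; rewrite inE /= in_itv /= andbT => u0.
  move: uC; rewrite ltNge u0 /= => /ltW /bigr /vd; rewrite /f => ->.
  by rewrite mulr0.
have intf : mu.-integrable half_line (EFin \o f).
  apply: (proj2 (integrable_mkcond _ measurable_half_line)); rewrite -fres.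
  apply: (proj1 (integrable_mkcond _ _)); first exact: measurable_itv.
  apply: continuous_compact_integrable; first exact: segment_compact.
  exact: continuous_subspaceT.
have [intp E] := integral_polar intf mf.
transitivity (\int[mu \x mu]_p (f (sum_sqr p))%:E)%E.
  by rewrite -integral12_prod_meas1.
rewrite E integral_mkcond -fres -integral_mkcond.
pose P (u : R) := 2 * c * e (Num.sqrt (s ^+ 2 + u)).
have cP : continuous P.
  move=> u; apply: cvgM; first exact: cvg_cst.
  by apply: (continuous_comp (f := fun u : R => Num.sqrt (s ^+ 2 + u)));
    [exact: cs|exact: ce].
have dP (u : R) : 0 < u -> is_derive u (1 : R) P (f u).
  move=> u0; have su : 0 < s ^+ 2 + u by rewrite ltr_wpDl// sqr_ge0.
  have d1 : is_derive u (1 : R) (fun u : R => s ^+ 2 + u) 1.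
    apply: (is_derive_ext _ (is_deriveD (is_derive_cst (s ^+ 2) u (1 : R))
      (is_derive_id u (1 : R)))) => //.
    by rewrite add0r.
  have d2 := is_derive1_comp (is_derive1_sqrt su) d1.
  have d3 := is_derive1_comp (smooth1_is_derive 0 _ ee.1) d2.
  apply: (is_derive_ext _ (is_deriveZ (2 * c) d3)) => //.
  rewrite /f /rderive /quot gt_eqF ?sqrtr_gt0//.
  change (2 * c * (derive1 e (Num.sqrt (s ^+ 2 + u)) *
    ((2 * Num.sqrt (s ^+ 2 + u))^-1 * 1)) =
    c * (derive1 e (Num.sqrt (s ^+ 2 + u)) / Num.sqrt (s ^+ 2 + u))).
  have n0 : Num.sqrt (s ^+ 2 + u) != 0 by rewrite gt_eqF// sqrtr_gt0.
  by field.
rewrite (@continuous_FTC2 _ f P)//; first last.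
- move=> u; rewrite in_itv /= => /andP[u0 _].
  by rewrite derive1E; exact: (@derive_val _ _ _ _ _ _ _ (dP u u0)).
- split=> [u||].
  + by rewrite in_itv /= => /andP[u0 _]; have [] := dP u u0.
  + exact/cvg_at_right_filter/cP.
  + exact/cvg_at_left_filter/cP.
- exact: continuous_subspaceT.
rewrite -EFinB -EFinM; congr EFin.
rewrite /P (eB _ (bigr C (lexx C))) addr0 sqrtr_sqr.
have -> : e `|s| = e s by case: (ler0P s) => _; rewrite ?ee.2.
by ring.
Qed.

Lemma continuous_sqrt_shift (h : R -> R) (s : R) : continuous h ->
  continuous (fun u => h (Num.sqrt (s ^+ 2 + u))).
Proof.
move=> ch u; apply: (continuous_comp (f := fun u : R => Num.sqrt (s ^+ 2 + u))).
  apply: (continuous_comp (f := fun u : R => s ^+ 2 + u)).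
    by apply: cvgD; [exact: cvg_cst|exact: cvg_id].
  exact: sqrt_continuous.
exact: ch.
Qed.

Lemma measurable_radial n (h : R -> R) (s : R) : continuous h ->
  measurable_fun setT (fun t : tup n => h (Num.sqrt (s ^+ 2 + tuple_dot t t))).
Proof.
move=> ch; have m1 : measurable_fun setT (fun u : R => h (Num.sqrt (s ^+ 2 + u))).
  by apply: continuous_measurable_fun; exact: continuous_sqrt_shift.
exact: (measurableT_comp m1 (@measurable_tuple_sqr n)).
Qed.

Lemma integrable_radial n (h : R -> R) (B s : R) (chi : tup n -> R) :
  continuous h -> 0 <= B -> vanish_beyond B h ->
  measurable_fun setT chi -> (forall t, `|chi t| <= 1) ->
  (leb n).-integrable setT
    (fun t => (h (Num.sqrt (s ^+ 2 + tuple_dot t t)) * chi t)%:E).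
Proof.
move=> ch B0 hB mchi chi1; have [M hM] := vanish_bounded ch hB.
apply: (@integrable_bounded_support n _ M (B ^+ 2)).
- by apply: measurable_funM => //; exact: measurable_radial.
- move=> t; rewrite normrM (le_trans (ler_wpM2l (normr_ge0 _) (chi1 t)))//.
  by rewrite mulr1.
move=> t Bt; rewrite hB ?mul0r// ger0_norm ?sqrtr_ge0//.
rewrite -(ger0_norm B0) -sqrtr_sqr ltr_sqrt.
  by rewrite (lt_le_trans Bt)// lerDr sqr_ge0.
by rewrite ltr_wpDl ?sqr_ge0// (le_lt_trans _ Bt)// sqr_ge0.
Qed.

Lemma integrable_radial1 n (h : R -> R) (B s : R) :
  continuous h -> 0 <= B -> vanish_beyond B h ->
  (leb n).-integrable setT (fun t => (h (Num.sqrt (s ^+ 2 + tuple_dot t t)))%:E).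
Proof.
move=> ch B0 hB; rewrite (_ : (fun t => _) = (fun t : tup n =>
  (h (Num.sqrt (s ^+ 2 + tuple_dot t t)) * cst 1 t)%:E)); last first.
  by apply/funext => t /=; rewrite mulr1.
apply: (@integrable_radial n _ B s (cst 1) ch B0 hB (measurable_cst _)).
by move=> t; rewrite normr1.
Qed.

Lemma tuple_dot0 (t u : tup 0) : tuple_dot t u = 0.
Proof. by rewrite /tuple_dot big_ord0. Qed.

(** Two coordinates are integrated out at a time, each pair undoing one application
    of [rderive]. *)
Lemma integral_iter_rderive n (e : R -> R) (B s : R) : smooth_even e -> 0 <= B ->
  vanish_beyond B e ->
  (\int[leb n.*2]_t (iter n rderive e (Num.sqrt (s ^+ 2 + tuple_dot t t)))%:E =
  ((- (2 * pi)) ^+ n * e s)%:E)%E.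
Proof.
elim: n e s => [|n IH] e s ee B0 eB.
  rewrite expr0 mul1r [LHS](integral_dirac [tuple] measurableT); last first.
    by apply/measurable_EFinP; apply: measurable_radial; exact: smooth_even_continuous.
  rewrite diracT mul1e tuple_dot0 addr0 sqrtr_sqr.
  have -> : iter 0 rderive e `|s| = e s by case: (ler0P s) => _; rewrite /= ?ee.2.
  by [].
have ed : smooth_even (rderive e) := smooth_even_iter_rderive 1 ee.
have vd := vanish_rderive B0 eB.
have en := smooth_even_continuous (smooth_even_iter_rderive n ed).
have vn := vanish_iter_rderive n B0 vd.
have int1 m s' := @integrable_radial1 m _ B s' en B0 vn.
rewrite doubleS iterSr integral_cons; last exact: int1.
transitivity (\int[mu]_x \int[mu]_y
    ((- (2 * pi)) ^+ n * rderive e (Num.sqrt (s ^+ 2 + (x ^+ 2 + y ^+ 2))))%:E)%E.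
  apply: eq_integral => x _.
  have sx y : Num.sqrt (s ^+ 2 + (x ^+ 2 + y ^+ 2)) ^+ 2 = s ^+ 2 + (x ^+ 2 + y ^+ 2).
    by rewrite sqr_sqrtr// !addr_ge0 ?sqr_ge0.
  rewrite integral_cons; last first.
    have := int1 n.*2.+1 (Num.sqrt (s ^+ 2 + x ^+ 2)).
    rewrite sqr_sqrtr ?addr_ge0 ?sqr_ge0//.
    rewrite (_ : (fun t => _) = (fun t : tup n.*2.+1 => (iter n rderive (rderive e)
      (Num.sqrt (s ^+ 2 + tuple_dot (cons_pair (x, t)) (cons_pair (x, t)))))%:E))//.
    by apply/funext => t; rewrite tuple_dot_cons -expr2 addrA.
  apply: eq_integral => y _; rewrite -IH//; apply: eq_integral => t _.
  by rewrite sx !tuple_dot_cons -!expr2 !addrA.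
rewrite (@integral_plane_rderive _ B)//.
by rewrite exprS.
Qed.

Lemma ge0_integral_opp (f : measurableTypeR R -> \bar R) :
  measurable_fun setT f -> (forall t, (0 <= f t)%E) ->
  (\int[mu]_x f (- x)%R = \int[mu]_x f x)%E.
Proof.
move=> mf f0.
have mo : measurable_fun setT (fun x : measurableTypeR R => - x : measurableTypeR R).
  exact: oppr_measurable.
have := @ge0_integral_pushforward _ _ _ _ R _ mo mu setT f measurableT mf
  (fun t _ => f0 t).
rewrite preimage_setT => <-; apply: eq_measure_integral => A mA _.
exact: lebesgue_measureN.
Qed.

Lemma integral_odd0 (g : R -> R) : mu.-integrable setT (EFin \o g) ->
  (forall x, g (- x) = - g x) -> (\int[mu]_x (g x)%:E = 0)%E.
Proof.
move=> intg gN; pose G : measurableTypeR R -> \bar R := EFin \o g.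
have mG : measurable_fun setT G by exact: (measurable_int mu intg).
have E : (\int[mu]_x (G^\+ x) = \int[mu]_x (G^\- x))%E.
  rewrite -(ge0_integral_opp (measurable_funepos mG) (funepos_ge0 G)).
  by apply: eq_integral => x _; rewrite funeposE funenegE /G /= gN EFinN.
rewrite [LHS]integralE.
change (\int[mu]_x (G^\+ x) - \int[mu]_x (G^\- x) = 0)%E.
rewrite E subee//; exact: integrable_neg_fin_num intg.
Qed.

Lemma integrable_vanish (p : R -> R) (B : R) : continuous p -> vanish_beyond B p ->
  mu.-integrable setT (EFin \o p).
Proof.
move=> cp pB; rewrite (_ : EFin \o p = (EFin \o p) \_ `[- B, B]%classic).
  apply: (proj1 (integrable_mkcond _ _)); first exact: measurable_itv.
  apply: continuous_compact_integrable; first exact: segment_compact.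
  exact: continuous_subspaceT.
apply/funext => x; rewrite /patch; case: ifPn => // /negP.
by rewrite inE /= in_itv /= -ler_norml => /negP; rewrite -ltNge => /pB ->.
Qed.

Lemma integral_derivative0 (P p : R -> R) (B : R) : 0 <= B ->
  (forall x : R, is_derive x (1 : R) P (p x)) -> continuous p ->
  vanish_beyond B P -> vanish_beyond B p -> (\int[mu]_x (p x)%:E = 0)%E.
Proof.
move=> B0 dP cp vP vp; pose C := B + 1.
have cP : continuous P.
  by move=> x; apply/differentiable_continuous/derivable1_diffP; have [] := dP x.
have -> : (\int[mu]_x (p x)%:E = \int[mu]_(x in `[(- C)%R, C]) (p x)%:E)%E.
  rewrite [RHS]integral_mkcond; apply: eq_integral => x _; rewrite /patch.
  case: ifPn => // /negP; rewrite inE /= in_itv /= -ler_norml => /negP; rewrite -ltNge => Cx.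
  by rewrite vp// (lt_trans _ Cx)// ltrDl.
rewrite (@continuous_FTC2 _ p P); first last.
- by move=> x _; rewrite derive1E; exact: (@derive_val _ _ _ _ _ _ _ (dP x)).
- split=> [x _||].
  + by have [] := dP x.
  + exact/cvg_at_right_filter/cP.
  + exact/cvg_at_left_filter/cP.
- exact: continuous_subspaceT.
- by rewrite /C; lra.
have BC : B < `|C| by rewrite ger0_norm /C ?addr_ge0// ltrDl.
by rewrite !vP ?normrN// -EFinB subrr.
Qed.

(** The primitive that vanishes at minus infinity.  It is even because the derivative
    of [E(x) - E(-x)] is [o(x) + o(-x) = 0]; evenness makes it vanish near plus
    infinity as well. *)
Lemma odd_primitive (o : R -> R) (B : R) : smooth_odd o -> 0 <= B ->
  vanish_beyond B o -> exists E : R -> R, [/\ smooth_even E, vanish_beyond B E &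
    forall x : R, is_derive x (1 : R) E (o x)].
Proof.
move=> [so oN] B0 oB; have co : continuous o by exact: (@smooth1_continuous R o 0 so).
have into : mu.-integrable setT (EFin \o o) by exact: integrable_vanish co oB.
pose E (x : R) := \int[mu]_(t in `]-oo, x]) o t.
have dE (x : R) : is_derive x (1 : R) E (o x).
  have [||||d1 d2] := @continuous_FTC1 R o -oo%O x (x + 1).
  - by rewrite ltrDl.
  - apply: (@integrableS _ _ _ mu setT) => //; exact: measurable_itv.
  - by rewrite ltNyr.
  - exact: co.
  by apply: (DeriveDef d1); rewrite -derive1E.
have EN x : E (- x) = E x.
  have dD (y : R) : is_derive y (1 : R) (fun y => E y - E (- y)) 0.
    apply: (is_derive_ext _ (is_deriveB (dE y) (is_derive1_oppr (dE (- y))))) => //.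
    by rewrite oN opprK subrr.
  have [c _] := mvt_from0 x dD; rewrite oppr0 !mul0r !subrr !subr0.
  by move/eqP; rewrite subr_eq0 => /eqP.
have EB x : x < - B -> E x = 0.
  move=> xB; rewrite /E; transitivity (\int[mu]_(t in `]-oo, x]) (cst 0 t)).
    apply: eq_Rintegral => t; rewrite inE /= in_itv /= => tx.
    rewrite oB// ler0_norm; first lra.
    by lra.
  by rewrite /Rintegral integral0.
exists E; split; [|clear dE co so|exact: dE].
  exact: (conj (smooth1_prim dE so) EN).
move=> x; rewrite lter_normr => /orP[Bx|Bx]; last by rewrite EB//; lra.
by rewrite -EN EB//; lra.
Qed.

Lemma measurable_scaled_cos (c : R) : measurable_fun setT (fun x : R => cos (c * x)).
Proof.
apply: continuous_measurable_fun => x.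
apply: (continuous_comp (f := fun x : R => c * x)); last exact: continuous_cos.
by apply: cvgM; [exact: cvg_cst|exact: cvg_id].
Qed.

Lemma measurable_scaled_sin (c : R) : measurable_fun setT (fun x : R => sin (c * x)).
Proof.
apply: continuous_measurable_fun => x.
apply: (continuous_comp (f := fun x : R => c * x)); last exact: continuous_sin.
by apply: cvgM; [exact: cvg_cst|exact: cvg_id].
Qed.

(** A rotation turns the plane wave into a wave along the first axis, and the other
    [2n] coordinates are integrated out by [integral_iter_rderive]. *)
Lemma integral_radial_wave n (xi : tup n.*2.+1) :
  exists2 rho : R, rho ^+ 2 = tuple_dot xi xi &
    forall (E : R -> R) (B : R) (chi : R -> R),
    smooth_even E -> 0 <= B -> vanish_beyond B E ->
    measurable_fun setT chi -> (forall x, `|chi x| <= 1) ->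
    \int[leb n.*2.+1]_t (iter n rderive E (Num.sqrt (tuple_dot t t)) * chi (tuple_dot xi t)) =
    (- (2 * pi)) ^+ n * \int[mu]_x (E x * chi (rho * x)).
Proof.
have [rho [phi [rhoE mphi phiN phiX]]] := rotation_to_first_axis xi.
exists rho => // E B chi eE B0 EB mchi chi1.
have cn := smooth_even_continuous (smooth_even_iter_rderive n eE).
have vn := vanish_iter_rderive n B0 EB.
have mrad m : measurable_fun setT (fun t : tup m => iter n rderive E (Num.sqrt (tuple_dot t t))).
  rewrite (_ : (fun t => _) = (fun t : tup m =>
    iter n rderive E (Num.sqrt (0 ^+ 2 + tuple_dot t t)))).
    exact: (@measurable_radial m _ 0 cn).
  by apply/funext => t; rewrite expr0n /= add0r.
have mrho : measurable_fun setT (fun x : R => chi (rho * x)).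
  by apply: measurableT_comp => //; exact: measurable_funM.
have cE := smooth_even_continuous eE.
have intE : mu.-integrable setT (fun x => (E x * chi (rho * x))%:E).
  have mE : measurable_fun setT E by exact: continuous_measurable_fun.
  apply: (le_integrable measurableT _ _ (integrable_vanish cE EB)).
    by apply/measurable_EFinP; exact: measurable_funM.
  move=> x _ /=; rewrite lee_fin normrM -[leRHS]mulr1.
  exact: ler_wpM2l.
rewrite -RintegralZl//; rewrite /Rintegral; congr fine.
transitivity (\int[leb n.*2.+1]_t
    (iter n rderive E (Num.sqrt (0 ^+ 2 + tuple_dot t t)) * chi (rho * thead t))%:E)%E.
  have mf : measurable_fun setT (fun t : tup n.*2.+1 =>
      (iter n rderive E (Num.sqrt (tuple_dot t t)) * chi (tuple_dot xi t))%:E).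
    apply/measurable_EFinP; apply: measurable_funM; first exact: mrad.
    exact: (measurableT_comp mchi (@measurable_tuple_dot _ xi)).
  rewrite -(measure_preserving_integral mphi mf); apply: eq_integral => t _.
  by rewrite phiN phiX expr0n /= add0r.
rewrite integral_cons; last first.
  apply: (@integrable_radial _ _ B 0 (fun t => chi (rho * thead t)) cn B0 vn) => //.
  exact: (measurableT_comp mrho (@measurable_thead _)).
apply: eq_integral => x _; rewrite mulrA [in RHS]EFinM -(integral_iter_rderive n x eE B0 EB).
rewrite -integralZr//; last first.
  exact: integrable_radial1 cn B0 vn.
apply: eq_integral => t _; rewrite thead_cons tuple_dot_cons -expr2 expr0n /= add0r.
by rewrite EFinM.
Qed.

Lemma Rintegral_opp (f : R -> R) : measurable_fun setT f ->
  \int[mu]_x f (- x) = \int[mu]_x f x.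
Proof.
move=> mf; pose F : measurableTypeR R -> \bar R := EFin \o f.
have mF : measurable_fun setT F by exact/measurable_EFinP.
rewrite /Rintegral; congr fine; rewrite [LHS]integralE [RHS]integralE.
congr (_ - _)%E.
  apply: etrans (ge0_integral_opp (measurable_funepos mF) (funepos_ge0 F)).
  by apply: eq_integral => x _; rewrite (funepos_comp F -%R).
apply: etrans (ge0_integral_opp (measurable_funeneg mF) (funeneg_ge0 F)).
by apply: eq_integral => x _; rewrite (funeneg_comp F -%R).
Qed.

Lemma Rintegral_odd0 (g : R -> R) : mu.-integrable setT (EFin \o g) ->
  (forall x, g (- x) = - g x) -> \int[mu]_x g x = 0.
Proof. by move=> intg gN; rewrite /Rintegral integral_odd0. Qed.

Definition cosine_transform (p : R -> R) (r : R) := \int[mu]_x (p x * cos (2 * pi * (r * x))).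

Definition sine_transform (p : R -> R) (r : R) := \int[mu]_x (p x * sin (2 * pi * (r * x))).

Lemma continuous_cos_wave (r : R) : continuous (fun x : R => cos (2 * pi * (r * x))).
Proof.
move=> x; apply: (continuous_comp (f := fun x : R => 2 * pi * (r * x))).
  by apply: cvgM; [exact: cvg_cst|apply: cvgM; [exact: cvg_cst|exact: cvg_id]].
exact: continuous_cos.
Qed.

Lemma continuous_sin_wave (r : R) : continuous (fun x : R => sin (2 * pi * (r * x))).
Proof.
move=> x; apply: (continuous_comp (f := fun x : R => 2 * pi * (r * x))).
  by apply: cvgM; [exact: cvg_cst|apply: cvgM; [exact: cvg_cst|exact: cvg_id]].
exact: continuous_sin.
Qed.

Lemma vanish_mull B (p q : R -> R) : vanish_beyond B p ->
  vanish_beyond B (fun x => p x * q x).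
Proof. by move=> pB x /pB ->; rewrite mul0r. Qed.

Lemma integrable_cos_wave (p : R -> R) (B r : R) : continuous p -> vanish_beyond B p ->
  mu.-integrable setT (fun x => (p x * cos (2 * pi * (r * x)))%:E).
Proof.
move=> cp pB; apply: (integrable_vanish _ (vanish_mull _ pB)) => x.
exact: (cvgM (cp x) (@continuous_cos_wave r x)).
Qed.

Lemma integrable_sin_wave (p : R -> R) (B r : R) : continuous p -> vanish_beyond B p ->
  mu.-integrable setT (fun x => (p x * sin (2 * pi * (r * x)))%:E).
Proof.
move=> cp pB; apply: (integrable_vanish _ (vanish_mull _ pB)) => x.
exact: (cvgM (cp x) (@continuous_sin_wave r x)).
Qed.

Lemma cosine_transformN p r : cosine_transform p (- r) = cosine_transform p r.
Proof. by apply: eq_Rintegral => x _; rewrite mulNr mulrN cosN. Qed.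

Lemma sine_transformN (p : R -> R) (B r : R) : continuous p -> vanish_beyond B p ->
  sine_transform p (- r) = - sine_transform p r.
Proof.
move=> cp pB; rewrite /sine_transform -[RHS]mulN1r -RintegralZl//; last first.
  exact: integrable_sin_wave cp pB.
by apply: eq_Rintegral => x _; rewrite mulNr mulrN sinN mulrN mulN1r.
Qed.

Lemma sine_transform_oddp (p : R -> R) (B r : R) : continuous p -> vanish_beyond B p ->
  sine_transform (oddp p) r = 2 * sine_transform p r.
Proof.
move=> cp pB; have int1 := integrable_sin_wave r cp pB.
have cpN : continuous (fun x => p (- x)).
  move=> x; apply: (continuous_comp (f := -%R)); [exact: opp_continuous|exact: cp].
have pNB : vanish_beyond B (fun x => p (- x)) by move=> x Bx; rewrite pB// normrN.
have int2 := integrable_sin_wave r cpN pNB.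
transitivity (sine_transform p r - sine_transform (fun x => p (- x)) r).
  rewrite /sine_transform -RintegralB//; apply: eq_Rintegral => x _.
  by rewrite /oddp mulrBl.
have -> : sine_transform (fun x => p (- x)) r = - sine_transform p r.
  rewrite /sine_transform -Rintegral_opp; last first.
    apply: continuous_measurable_fun => x.
    exact: (cvgM (cpN x) (@continuous_sin_wave r x)).
  rewrite -[RHS]mulN1r -RintegralZl//; apply: eq_Rintegral => x _.
  by rewrite opprK !mulrN sinN mulN1r mulrN.
by rewrite opprK mulr_natl mulr2n.
Qed.

(** Integration by parts; there is no boundary term because [E] has bounded
    support. *)
Lemma sine_transform_primitive (E o : R -> R) (B r : R) : 0 <= B ->
  (forall x : R, is_derive x (1 : R) E (o x)) -> continuous o ->
  vanish_beyond B E -> vanish_beyond B o ->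
  sine_transform o r = r * (- (2 * pi) * cosine_transform E r).
Proof.
move=> B0 dE co EB oB.
have cE : continuous E.
  by move=> x; apply/differentiable_continuous/derivable1_diffP; have [] := dE x.
pose p (x : R) := o x * sin (2 * pi * (r * x)) + 2 * pi * r * (E x * cos (2 * pi * (r * x))).
have ds (x : R) : is_derive x (1 : R) (fun x : R => sin (2 * pi * (r * x)))
    (cos (2 * pi * (r * x)) * (2 * pi * r)).
  have dl : is_derive x (1 : R) (fun x : R => 2 * pi * (r * x)) (2 * pi * r).
    apply: (is_derive_ext _ (is_deriveZ (2 * pi * r) (is_derive_id x (1 : R)))) => [y|].
      by rewrite /= mulrA.
    by rewrite /GRing.scale /= mulr1.
  exact: (is_derive1_comp (is_derive_sin _) dl).
have dP (x : R) : is_derive x (1 : R) (fun x => E x * sin (2 * pi * (r * x))) (p x).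
  apply: (is_derive_ext _ (is_deriveM (dE x) (ds x))) => //.
  by rewrite /GRing.scale /= /p; ring.
have cs := @continuous_sin_wave r; have cc := @continuous_cos_wave r.
have cp : continuous p.
  move=> x; exact: (cvgD (cvgM (co x) (cs x)) (cvgM (cvg_cst (2 * pi * r)) (cvgM (cE x) (cc x)))).
have pB : vanish_beyond B p.
  by move=> x Bx; rewrite /p oB// EB// !mul0r mulr0 addr0.
have : \int[mu]_x p x = 0.
  by rewrite /Rintegral (integral_derivative0 B0 dP cp (vanish_mull _ EB) pB).
have ic := integrable_cos_wave r cE EB; have is_ := integrable_sin_wave r co oB.
have ic' : mu.-integrable setT (fun x => (2 * pi * r * (E x * cos (2 * pi * (r * x))))%:E).
  exact: (integrableZl measurableT (2 * pi * r) ic).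
rewrite RintegralD// RintegralZl// -/(sine_transform o r) -/(cosine_transform E r).
by move/eqP; rewrite addr_eq0 => /eqP ->; ring.
Qed.

Lemma cosine_transform_cvg0 (E : R -> R) (B : R) : continuous E -> vanish_beyond B E ->
  cosine_transform E r @[r --> 0] --> cosine_transform E 0.
Proof.
move=> cE EB; have intE := integrable_vanish cE EB.
have := @continuity_under_integral R _ _ mu (fun r x => E x * cos (2 * pi * (r * x)))
  setT measurableT (-1) 1 _ _ (fun x => `|E x|) _ _ 0.
apply.
- by move=> r _; exact: integrable_cos_wave cE EB.
- apply: aeW => x _ r _; apply: cvgM; first exact: cvg_cst.
  apply: (continuous_comp (f := fun r : R => 2 * pi * (r * x))).
    by apply: cvgM; [exact: cvg_cst|apply: cvgM; [exact: cvg_id|exact: cvg_cst]].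
  exact: continuous_cos.
- exact: integrable_norm intE.
- move=> r _; apply: aeW => x _; rewrite normrM -[leRHS]mulr1 ler_wpM2l//.
  exact: cos_max.
by rewrite inE /= in_itv /= ltrN10 ltr01.
Qed.

(** Continuity of [K] at the origin suffices for [r * K r] to be differentiable
    there. *)
Lemma quot_mul (K : R -> R) r : K h @[h --> 0] --> K 0 ->
  quot (fun r => r * K r) r = K r.
Proof.
move=> K0; rewrite /quot; case: eqP => [->|/eqP r0]; last by rewrite mulrAC divff ?mul1r.
rewrite derive1E; apply/cvg_lim => //=.
apply/cvgrPdist_le => e e0; move/cvgrPdist_le : K0 => /(_ e e0)[d d0 hd].
exists d => // h hb h0; have := hd h hb.
by rewrite scaler1 addr0 mul0r subr0 /GRing.scale /= mulrA mulVf ?mul1r.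
Qed.

(** The case of [integral_radial_wave] where one application of [rderive] is spent
    on an even primitive [E] of [o]: [rderive E = quot o]. *)
Lemma radial_transform m (xi : tup m.+1.*2.+1) : exists2 rho : R,
  rho ^+ 2 = tuple_dot xi xi & forall (E o : R -> R) (B : R), smooth_even E -> 0 <= B ->
    vanish_beyond B E -> (forall x : R, is_derive x (1 : R) E (o x)) ->
    \int[leb _]_t (iter m rderive (quot o) (Num.sqrt (tuple_dot t t)) *
      cos (2 * pi * tuple_dot xi t)) = (- (2 * pi)) ^+ m.+1 * cosine_transform E rho /\
    \int[leb _]_t (iter m rderive (quot o) (Num.sqrt (tuple_dot t t)) *
      sin (2 * pi * tuple_dot xi t)) = 0.
Proof.
have [rho rhoE h] := integral_radial_wave xi; exists rho => // E o B eE B0 EB dE.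
have -> : quot o = rderive E.
  by congr quot; apply/funext => x; rewrite derive1E; have [] := dE x.
rewrite -iterSr; split.
  rewrite (h E B (fun y => cos (2 * pi * y)))//; first exact: measurable_scaled_cos.
  by move=> x; exact: cos_max.
rewrite (h E B (fun y => sin (2 * pi * y)))//; last 2 first.
- exact: measurable_scaled_sin.
- by move=> x; exact: sin_max.
rewrite Rintegral_odd0 ?mulr0//.
  exact: integrable_sin_wave (smooth_even_continuous eE) EB.
by move=> x; rewrite eE.2 !mulrN sinN mulrN.
Qed.

Lemma integrable_radial_wave n (h chi : R -> R) (B : R) (xi : tup n) :
  continuous h -> 0 <= B -> vanish_beyond B h ->
  measurable_fun setT chi -> (forall x, `|chi x| <= 1) ->
  (leb n).-integrable setT
    (fun t => (h (Num.sqrt (tuple_dot t t)) * chi (tuple_dot xi t))%:E).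
Proof.
move=> ch B0 hB mchi chi1.
rewrite (_ : (fun t => _) = (fun t : tup n =>
  (h (Num.sqrt (0 ^+ 2 + tuple_dot t t)) * chi (tuple_dot xi t))%:E)); last first.
  by apply/funext => t; rewrite expr0n /= add0r.
apply: (@integrable_radial n h B 0 (fun t => chi (tuple_dot xi t)))=> //.
exact: (measurableT_comp mchi (@measurable_tuple_dot n xi)).
Qed.

End LebesgueMeasureOnTuples.

(** * Iterating [(1/r) d/dr] on [o(r)/r] *)
Section CombinatorialIdentity.
Variable R : realType.

(** Up to sign, the coefficient of [X^j] in the reverse Bessel polynomial of degree
    [m]. *)
Definition bessel_coef (m j : nat) : R :=
  (-1) ^+ (m + j) * ((2 * m - j)`!)%N%:R / (j`! * double_fact (2 * m - 2 * j))%N%:R.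

Lemma double_factS n : double_fact n.+2 = (n.+2 * double_fact n)%N.
Proof. by []. Qed.

Lemma double_fact_gt0 n : (0 < double_fact n)%N.
Proof.
have : (0 < double_fact n)%N && (0 < double_fact n.+1)%N.
  by elim: n => // n /andP[h1 h2]; rewrite h2 double_factS muln_gt0 h1.
by case/andP.
Qed.

Lemma bessel_coef0 m : bessel_coef m.+1 0 = - (2 * m + 1)%N%:R * bessel_coef m 0.
Proof.
rewrite /bessel_coef !addn0 !subn0 ?muln0 ?subn0 fact0 !mul1n exprS.
rewrite (_ : 2 * m.+1 = (2 * m).+2)%N; last by rewrite mulnS.
rewrite double_factS !factS !natrM addn1.
have d0 : (double_fact (2 * m))%:R != 0 :> R by rewrite pnatr_eq0 -lt0n double_fact_gt0.
have m0 : (2 * m).+2%:R != 0 :> R by rewrite pnatr_eq0.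
move: d0 m0; set a := (double_fact _)%:R; set b := (2 * m).+2%:R.
set c := (2 * m).+1%:R; set f := _`!%:R; set s := (-1) ^+ m.
move: a b c f s => a b c f s a0 b0; by field; rewrite a0 b0.
Qed.

Lemma bessel_coef_diag m : bessel_coef m.+1 m.+1 = bessel_coef m m.
Proof.
rewrite /bessel_coef !subnn muln1 muln1.
rewrite (_ : 2 * m.+1 - m.+1 = m.+1)%N; last by rewrite mul2n -addnn addnK.
rewrite (_ : 2 * m - m = m)%N; last by rewrite mul2n -addnn addnK.
rewrite !mulfK ?pnatr_eq0 -?lt0n ?fact_gt0//.
by rewrite addSn addnS !exprS mulrA mulrNN mulr1 mul1r.
Qed.

(** Together with [bessel_coef0] and [bessel_coef_diag], the recurrence that results
    from differentiating the identity of [iter_rderive_quotE]. *)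
Lemma bessel_coefS m j : (j < m)%N -> bessel_coef m.+1 j.+1 =
  bessel_coef m j + (j.+1%:R - (2 * m + 1)%N%:R) * bessel_coef m j.+1.
Proof.
move=> jm; have [l ->] : exists l, m = (j.+1 + l)%N by exists (m - j.+1)%N; rewrite subnKC.
rewrite /bessel_coef.
rewrite (_ : 2 * (j.+1 + l).+1 - j.+1 = (j + 2 * l).+3)%N; last by lia.
rewrite (_ : 2 * (j.+1 + l).+1 - 2 * j.+1 = (2 * l).+2)%N; last by lia.
rewrite (_ : 2 * (j.+1 + l) - j = (j + 2 * l).+2)%N; last by lia.
rewrite (_ : 2 * (j.+1 + l) - 2 * j = (2 * l).+2)%N; last by lia.
rewrite (_ : 2 * (j.+1 + l) - j.+1 = (j + 2 * l).+1)%N; last by lia.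
rewrite (_ : 2 * (j.+1 + l) - 2 * j.+1 = (2 * l))%N; last by lia.
rewrite double_factS (factS j) (factS (j + 2 * l).+2) (factS (j + 2 * l).+1) !natrM.
have d0 : (double_fact (2 * l))%:R != 0 :> R by rewrite pnatr_eq0 -lt0n double_fact_gt0.
have f0 : (j`!)%:R != 0 :> R by rewrite pnatr_eq0 -lt0n fact_gt0.
have j0 : j.+1%:R != 0 :> R by rewrite pnatr_eq0.
have l0 : (2 * l).+2%:R != 0 :> R by rewrite pnatr_eq0.
have [N NE] : exists N, N = (j.+1 + l + j)%N by eexists.
rewrite (_ : (j.+1 + l).+1 + j.+1 = N.+2)%N; last by lia.
rewrite (_ : j.+1 + l + j.+1 = N.+1)%N; last by lia.
rewrite (_ : j.+1 + l + j = N)%N; last by lia.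
rewrite (exprS _ N.+1) (exprS _ N).
have -> : (2 * (j.+1 + l) + 1)%N%:R = 2 * j%:R + 2 * l%:R + 3 :> R.
  by rewrite -!natrM -!natrD; congr _%:R; lia.
have e1 : (j + 2 * l).+3%:R = j%:R + 2 * l%:R + 3 :> R by rewrite -natrM -!natrD; congr _%:R; lia.
have e2 : (j + 2 * l).+2%:R = j%:R + 2 * l%:R + 2 :> R by rewrite -natrM -!natrD; congr _%:R; lia.
have e3 : (2 * l).+2%:R = 2 * l%:R + 2 :> R by rewrite -natrM -!natrD; congr _%:R; lia.
have e4 : j.+1%:R = j%:R + 1 :> R by rewrite -natr1.
rewrite e1 e2 e3 e4; clear e1 e2 e3 e4 j0 l0.
have J0 : 0 <= j%:R :> R by []; have L0 : 0 <= l%:R :> R by [].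
move: d0 f0 J0 L0; set d := (double_fact _)%:R; set f := j`!%:R; set J := j%:R.
set L := l%:R; set g := _`!%:R; set s := (-1) ^+ _.
move: d f J L g s => d f J L g s d0 f0 J0 L0.
have J1 : J + 1 != 0 by apply: lt0r_neq0; lra.
have L1 : 2 * L + 2 != 0 by apply: lt0r_neq0; lra.
by field; rewrite ?d0 ?f0 ?J1 ?L1.
Qed.

(** By induction on [m]: differentiating the identity for [m] and multiplying it by
    [r] expresses [r^(2m+2) F'(r) = r^(2m+3) (F'(r)/r)] through the [r^j o^(j)(r)],
    and the coefficients are compared by the recurrence of [bessel_coef]. *)
Lemma iter_rderive_quotE m (o : R -> R) r : smooth_odd o ->
  iter m rderive (quot o) r * r ^+ (2 * m + 1) =
  \sum_(j < m.+1) bessel_coef m j * (r ^+ j * derive1n j o r).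
Proof.
move=> oo; have [so _] := oo; have o0 := smooth_odd0 oo.
elim: m r => [|m IH] r.
  have c0 : bessel_coef 0 0 = 1.
    by rewrite /bessel_coef addn0 expr0 mul1r; apply: divff; rewrite pnatr_eq0.
  rewrite big_ord1 c0 mul1r expr0 mul1r muln0 add0n expr1.
  change (quot o r * r = o r); rewrite /quot.
  by case: eqP => [->|/eqP r0]; [rewrite mulr0 o0|rewrite mulfVK].
have [->|r0] := eqVneq r 0.
  rewrite addn1 expr0n mulr0 big_ord_recl expr0 mul1r [derive1n _ _ _]o0 mulr0 add0r.
  by rewrite big1// => i _; rewrite expr0n mul0r mulr0.
set F := iter m rderive (quot o).
have eF : smooth_even F := smooth_even_iter_rderive m (smooth_even_quot oo).
have d1 := is_deriveM (smooth1_is_derive 0 r eF.1) (is_derive_id_X (2 * m + 1) r).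
have d2 : is_derive r (1 : R) (fun r => \sum_(j < m.+1) bessel_coef m j * (r ^+ j * derive1n j o r))
    (\sum_(j < m.+1) bessel_coef m j * (j%:R * r ^+ j.-1 * derive1n j o r + r ^+ j * derive1n j.+1 o r)).
  have := is_derive_sum (fun j : 'I_m.+1 => is_deriveZ (bessel_coef m j)
    (is_deriveM (is_derive_id_X j r) (smooth1_is_derive j r so))).
  move=> h; apply: (is_derive_ext _ h) => [x|].
    by rewrite fct_sumE.
  apply: eq_bigr => j _; rewrite /GRing.scale /= -/(derive1n j.+1 o).
  by congr (_ * _); rewrite addrC [in X in X + _ = _]mulrC.
have E : F * (fun x : R => x ^+ (2 * m + 1)) =
    (fun r => \sum_(j < m.+1) bessel_coef m j * (r ^+ j * derive1n j o r)).
  by apply/funext => x; exact: IH.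
have [_ h1] := d1; have [_ h2] := d2.
have : F r * ((2 * m + 1)%N%:R * r ^+ (2 * m)) + r ^+ (2 * m + 1) * derive1 F r =
    \sum_(j < m.+1) bessel_coef m j * (j%:R * r ^+ j.-1 * derive1n j o r + r ^+ j * derive1n j.+1 o r).
  rewrite -h2 -E; apply: etrans (esym h1); rewrite addn1; by [].
clear h1 h2 d1 d2 E => /(congr1 ( *%R r)) key.
(* The terms come from [r (r^j o^(j))' = j r^j o^(j) + r^(j+1) o^(j+1)] *)
pose X j := r ^+ j * derive1n j o r.
have {}key : r ^+ (2 * m + 2) * derive1 F r = \sum_(j < m.+1) bessel_coef m j * X j.+1 +
    \sum_(j < m.+1) (j%:R - (2 * m + 1)%N%:R) * bessel_coef m j * X j.
  have step : r * (\sum_(j < m.+1) bessel_coef m j * (j%:R * r ^+ j.-1 * derive1n j o r +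
      r ^+ j * derive1n j.+1 o r)) = \sum_(j < m.+1) bessel_coef m j * X j.+1 +
      \sum_(j < m.+1) j%:R * bessel_coef m j * X j.
    rewrite mulr_sumr -big_split; apply: eq_bigr => -[j jm] _ /=.
    by rewrite /X; case: j jm => [|j] _ /=; rewrite !exprS; ring.
  rewrite step in key.
  have S1 : \sum_(j < m.+1) (j%:R - (2 * m + 1)%N%:R) * bessel_coef m j * X j =
      \sum_(j < m.+1) j%:R * bessel_coef m j * X j - (2 * m + 1)%N%:R * (F r * r ^+ (2 * m + 1)).
    rewrite IH mulr_sumr -sumrB; apply: eq_bigr => j _; rewrite /X; ring.
  rewrite S1 addrA -key !addnS !addn0 !exprS; ring.
rewrite (_ : iter m.+1 rderive (quot o) r = derive1 F r / r); last first.
  by rewrite /= /rderive {1}/quot (negbTE r0).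
rewrite (_ : 2 * m.+1 + 1 = (2 * m + 2).+1)%N; last by lia.
rewrite exprS mulrA mulfVK// mulrC key -/(X _).
rewrite big_ord_recr [X in _ + X = _]big_ord_recl [RHS]big_ord_recl big_ord_recr /=.
rewrite bessel_coef0 /bump /= !add1n bessel_coef_diag -!/(X _).
rewrite [Z in _ = _ + (Z + _)](eq_bigr (fun j : 'I_m => bessel_coef m j * X j.+1 +
  (j.+1%:R - (2 * m + 1)%N%:R) * bessel_coef m j.+1 * X j.+1)); last first.
  move=> j _; rewrite add1n -[r ^+ _ * _]/(X j.+1).
  by rewrite bessel_coefS// mulrDl.
rewrite [Z in _ + (_ + Z) = _](eq_bigr (fun j : 'I_m =>
  (j.+1%:R - (2 * m + 1)%N%:R) * bessel_coef m j.+1 * X j.+1)); last by [].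
by rewrite big_split /=; ring.
Qed.

End CombinatorialIdentity.

(** * Radial functions with a prescribed Fourier transform *)
Section RadialInversion.
Variable R : realType.
Local Notation mu := (@lebesgue_measure R).
Local Notation leb := (lebesgue_tuple R).
Local Notation tup n := (n.-tuple (measurableTypeR R)).

(** Normalised so that, in dimension [2m + 3], the Fourier transform of the radial
    function with this profile has the profile [2 S(r) / r], where [S] is the sine
    transform of [p]. *)
Definition radial_profile (m : nat) (p : R -> R) (r : R) : R :=
  ((- (2 * pi)) ^+ m)^-1 * iter m rderive (quot (oddp p)) r.

Lemma smooth_even_radial_profile m (p : R -> R) : smooth1 p ->
  smooth_even (radial_profile m p).
Proof.
move=> sp; have [sF eF] := smooth_even_iter_rderive m (smooth_even_quot_oddp sp).
split=> [|r]; last by rewrite /radial_profile eF.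
pose c : R := ((- (2 * pi)) ^+ m)^-1.
apply: (proj1 (@derive1nP R (radial_profile m p) (fun n r => c * derive1n n (iter m rderive (quot (oddp p))) r) _ _)) => // n r.
exact: (is_deriveZ c (smooth1_is_derive n r sF)).
Qed.

Lemma vanish_radial_profile m (p : R -> R) B : 0 <= B -> vanish_beyond B p ->
  vanish_beyond B (radial_profile m p).
Proof.
move=> B0 pB r Br; rewrite /radial_profile (vanish_iter_rderive m B0 _ Br) ?mulr0// => x Bx.
have x0 : x != 0 by rewrite -normr_gt0 (le_lt_trans B0).
by rewrite /quot (negbTE x0) /oddp !pB ?normrN// subrr mul0r.
Qed.

Lemma vanish_oddp (p : R -> R) B : vanish_beyond B p -> vanish_beyond B (oddp p).
Proof. by move=> pB x Bx; rewrite /oddp !pB ?normrN// subrr. Qed.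

(** With an even primitive [E] of [oddp p], both sides equal [- 2 pi] times the cosine
    transform of [E]: the left by [radial_transform], the right by integration by
    parts. *)
Lemma radial_profile_transform m (xi : tup m.+1.*2.+1) (p : R -> R) B :
  smooth1 p -> 0 <= B -> vanish_beyond B p ->
  \int[leb _]_t (radial_profile m p (Num.sqrt (tuple_dot t t)) *
    cos (2 * pi * tuple_dot xi t)) =
    quot (fun r => 2 * sine_transform p r) (Num.sqrt (tuple_dot xi xi)) /\
  \int[leb _]_t (radial_profile m p (Num.sqrt (tuple_dot t t)) *
    sin (2 * pi * tuple_dot xi t)) = 0.
Proof.
move=> sp B0 pB; have oo := smooth_odd_oddp sp; have oB := vanish_oddp pB.
have [E [eE EB dE]] := odd_primitive oo B0 oB.
have [rho rhoE h] := radial_transform xi.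
have [hc hs] := h E (oddp p) B eE B0 EB dE.
pose c : R := ((- (2 * pi)) ^+ m)^-1.
set F := iter m rderive (quot (oddp p)) in hc hs *.
have cF : continuous F.
  exact/smooth_even_continuous/smooth_even_iter_rderive/smooth_even_quot_oddp.
have FB : vanish_beyond B F.
  move: (vanish_radial_profile m B0 pB) => hB r Br; have /eqP := hB r Br.
  rewrite /radial_profile mulf_eq0 invr_eq0 expf_eq0 oppr_eq0 mulf_eq0 pnatr_eq0 /=.
  by rewrite gt_eqF ?pi_gt0// andbF => /eqP.
have ic := integrable_radial_wave xi cF B0 FB (@measurable_scaled_cos R (2 * pi)) (fun x => cos_max _).
have is_ := integrable_radial_wave xi cF B0 FB (@measurable_scaled_sin R (2 * pi)) (fun x => sin_max _).
have pull (chi : R -> R) : (leb _).-integrable setT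
      (fun t => (F (Num.sqrt (tuple_dot t t)) * chi (tuple_dot xi t))%:E) ->
    \int[leb _]_t (radial_profile m p (Num.sqrt (tuple_dot t t)) * chi (tuple_dot xi t)) =
    c * \int[leb _]_t (F (Num.sqrt (tuple_dot t t)) * chi (tuple_dot xi t)).
  move=> ichi; rewrite -RintegralZl//; apply: eq_Rintegral => t _.
  by rewrite mulrA.
split; last by rewrite (pull (fun y => sin (2 * pi * y)))// hs mulr0.
rewrite (pull (fun y => cos (2 * pi * y)))// hc mulrA exprSr mulrA /c mulVf ?mul1r; last first.
  by rewrite expf_neq0// oppr_eq0 mulf_neq0 ?pnatr_eq0// gt_eqF ?pi_gt0.
pose K r := - (2 * pi) * cosine_transform E r.
have cE := smooth_even_continuous eE.
have cp := @smooth1_continuous R p 0 sp.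
have co := @smooth1_continuous R (oddp p) 0 oo.1.
rewrite (_ : (fun r => _) = (fun r => r * K r)); last first.
  apply/funext => r; rewrite -(sine_transform_oddp r cp pB).
  exact: (sine_transform_primitive r B0 dE co EB oB).
rewrite (@quot_mul R K); last first.
  apply: cvgM; first exact: cvg_cst.
  exact: cosine_transform_cvg0 cE EB.
rewrite /K; congr (_ * _); have : `|rho| = Num.sqrt (tuple_dot xi xi).
  by rewrite -rhoE sqrtr_sqr.
by move=> <-; have [_|_] := ger0P rho => //; rewrite cosine_transformN.
Qed.

(** The radial profiles of the real and imaginary parts of [- i f]: the factor [- i]
    is that of the sine in the exponential kernel. *)
Definition radial_preimage (m : nat) (f : R -> R[i]) (x : 'rV[R]_(m.+1.*2.+1)) : R[i] :=
  radial_profile m (fun r => complex.Im (f r)) (enorm x) +i*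
  radial_profile m (fun r => - complex.Re (f r)) (enorm x).

Lemma smooth1_opp (p : R -> R) : smooth1 p ->
  smooth1 (fun r => - p r) /\ forall n, derive1n n (fun r => - p r) = fun r => - derive1n n p r.
Proof.
move=> sp; apply: (@derive1nP R (fun r => - p r) (fun n r => - derive1n n p r)) => // n r.
exact: (is_deriveN (smooth1_is_derive n r sp)).
Qed.

Lemma test_function_radial_preimage m (f : R -> R[i]) : test_function f ->
  test_function (@radial_preimage m f).
Proof.
move=> tf; have [B B0 hB] := test_function_line tf.
have [sr si] := (smooth_line f).1 tf.1.
have [sr' _] := smooth1_opp sr.
apply: (@test_function_bounded_support _ _ _ B).
  apply/smoothP; split; apply: rsmooth_radial.
    exact: (smooth_even_radial_profile m si).
  exact: (smooth_even_radial_profile m sr').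
move=> x xB; rewrite /radial_preimage.
have nx : B < `|enorm x| by rewrite ger0_norm// enorm_ge0.
rewrite !(vanish_radial_profile m (ltW B0) _ nx)// => r rB.
  by rewrite hB ?ltW//= oppr0.
by rewrite hB ?ltW.
Qed.

(** In [oddp (fourier1 f)] the cosine terms cancel, and only the sine transform of
    [- i f] is left. *)
Lemma radial_quotient_fourier1 m (f : R -> R[i]) : test_function f ->
  radial_quotient (fourier1 f) = fourier (@radial_preimage m f).
Proof.
move=> tf; have [B B0 hB] := test_function_line tf.
have [sr si] := (smooth_line f).1 tf.1; have [sr' _] := smooth1_opp sr.
pose u (r : R) := complex.Re (f r); pose w (r : R) := complex.Im (f r).
have uB : vanish_beyond B u by move=> r rB; rewrite /u hB ?ltW.
have wB : vanish_beyond B w by move=> r rB; rewrite /w hB ?ltW.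
have nuB : vanish_beyond B (fun r => - u r) by move=> r rB; rewrite uB// oppr0.
have cu := @smooth1_continuous R u 0 sr; have cw := @smooth1_continuous R w 0 si.
have cnu := @smooth1_continuous R _ 0 sr'.
have E1 r : complex.Re (fourier1 f r) = cosine_transform u r + sine_transform w r.
  rewrite /cosine_transform /sine_transform -RintegralD//; last 2 first.
  - exact: integrable_cos_wave cu uB.
  - exact: integrable_sin_wave cw wB.
  apply: eq_Rintegral => x _; rewrite -/(u x) -/(w x) /u /w.
  by case: (f x) => p q /=; rewrite cosN sinN mulrN opprK.
have E2 r : complex.Im (fourier1 f r) = cosine_transform w r + sine_transform (fun r => - u r) r.
  rewrite /cosine_transform /sine_transform -RintegralD//; last 2 first.
  - exact: integrable_cos_wave cw wB.
  - exact: integrable_sin_wave cnu nuB.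
  apply: eq_Rintegral => x _; rewrite /u /w.
  by case: (f x) => p q /=; rewrite cosN sinN mulrN mulNr addrC.
apply/funext => xi; pose t0 : tup m.+1.*2.+1 := [tuple xi 0 i | i < _].
have dE (t : tup m.+1.*2.+1) : dotp xi (\row_(i < _) tnth t i) = tuple_dot t0 t.
  by apply: eq_bigr => i _; rewrite mxE tnth_mktuple.
have nE (t : tup m.+1.*2.+1) : enorm (\row_(i < _) tnth t i) = Num.sqrt (tuple_dot t t).
  by congr Num.sqrt; apply: eq_bigr => i _; rewrite !mxE.
have nxi : enorm xi = Num.sqrt (tuple_dot t0 t0).
  by congr Num.sqrt; apply: eq_bigr => i _; rewrite !tnth_mktuple.
have int p (chi : R -> R) : smooth1 p -> vanish_beyond B p -> measurable_fun setT chi ->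
    (forall x, `|chi x| <= 1) -> (leb _).-integrable setT (fun t =>
      (radial_profile m p (Num.sqrt (tuple_dot t t)) * chi (tuple_dot t0 t))%:E).
  move=> sp pB; apply: integrable_radial_wave (ltW B0) (vanish_radial_profile m (ltW B0) pB).
  exact/smooth_even_continuous/smooth_even_radial_profile.
have mc := @measurable_scaled_cos R (2 * pi); have ms := @measurable_scaled_sin R (2 * pi).
have [wc ws] := radial_profile_transform t0 si (ltW B0) wB.
have [uc us] := radial_profile_transform t0 sr' (ltW B0) nuB.
rewrite /radial_quotient /fourier /cintegral nxi; congr (_ +i* _).
  transitivity (quot (fun r => 2 * sine_transform w r) (Num.sqrt (tuple_dot t0 t0))).
    congr quot; apply/funext => r; rewrite /oddp !E1 cosine_transformN.
    by rewrite (sine_transformN r cw wB); ring.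
  rewrite -wc -[LHS]addr0 -[X in _ + X = _]us -RintegralD//; last 2 first.
  - exact: (int w (fun y => cos (2 * pi * y)) si wB mc (fun x => cos_max _)).
  - exact: (int _ (fun y => sin (2 * pi * y)) sr' nuB ms (fun x => sin_max _)).
  by apply: eq_Rintegral => t _; rewrite /= nE dE cosN sinN mulrN opprK.
transitivity (quot (fun r => 2 * sine_transform (fun r => - u r) r) (Num.sqrt (tuple_dot t0 t0))).
  congr quot; apply/funext => r; rewrite /oddp !E2 cosine_transformN.
  by rewrite (sine_transformN r cnu nuB); ring.
rewrite -uc -[LHS]subr0 -[X in _ - X = _]ws -RintegralB//; last 2 first.
- exact: (int _ (fun y => cos (2 * pi * y)) sr' nuB mc (fun x => cos_max _)).
- exact: (int w (fun y => sin (2 * pi * y)) si wB ms (fun x => sin_max _)).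
by apply: eq_Rintegral => t _; rewrite /= nE dE cosN sinN mulrN addrC.
Qed.

Lemma beta_coefE m j : (j <= m)%N ->
  beta_coef R j m.+1.*2.+1 = ((- (2 * pi)) ^+ m)^-1 * bessel_coef R m j.
Proof.
move=> jm; rewrite /beta_coef /bessel_coef.
rewrite (_ : m.+1.*2.+1 - j - 3 = 2 * m - j)%N; last by lia.
rewrite (_ : m.+1.*2.+1 - 2 * j - 3 = 2 * m - 2 * j)%N; last by lia.
rewrite (_ : (m.+1.*2.+1 - 3)./2 = m)%N; last by rewrite -[RHS]doubleK; congr _./2; lia.
have -> : (- (2 * pi)) ^- m = (-1) ^+ m * (1 / (2 * pi)) ^+ m :> R.
  by rewrite div1r -exprMn mulN1r -invrN exprVn.
rewrite exprD.
have s1 : (-1) ^+ m * (-1) ^+ m = 1 :> R by rewrite -exprD addnn -mul2n exprM sqrrN expr1n expr1n.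
set P := (1 / _) ^+ m; set F : R := (_`!)%:R; set I := _^-1.
transitivity ((-1) ^+ m * (-1) ^+ m * ((-1) ^+ j * F * I * P)); first by rewrite s1 mul1r.
ring.
Qed.

Lemma radial_preimageE m (f : R -> R[i]) (s : 'rV[R]_(m.+1.*2.+1)) : smooth f ->
  radial_preimage f s * (enorm s ^+ (2 * m + 1))%:C =
  - 'i%C * \sum_(j < m.+1) (beta_coef R j m.+1.*2.+1)%:C * (enorm s ^+ j)%:C *
    ((-1) ^+ j * ddelta j (enorm s) f - ddelta j (- enorm s) f).
Proof.
move=> /smooth_line[sr si]; have [sr' dr'] := smooth1_opp sr.
set r := enorm s; set u := fun r => complex.Re (f r) in sr sr' dr' *.
set w := fun r => complex.Im (f r) in si *.
pose g (p : R -> R) j := derive1n j p r - (-1) ^+ j * derive1n j p (- r).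
have prof (p : R -> R) : smooth1 p -> radial_profile m p r * r ^+ (2 * m + 1) =
    \sum_(j < m.+1) beta_coef R j m.+1.*2.+1 * r ^+ j * g p j.
  move=> sp; rewrite /radial_profile -mulrA (iter_rderive_quotE m r (smooth_odd_oddp sp)).
  rewrite mulr_sumr; apply: eq_bigr => j _.
  have jm : (j <= m)%N by rewrite -ltnS.
  rewrite (beta_coefE jm) (derive1n_oddp sp).2 -/(g p j); move: (g p j) => G.
  by rewrite -!mulrA.
have gN j : g (fun r => - u r) j = - g u j by rewrite /g !dr'; ring.
have dd j : (-1) ^+ j * ddelta j r f - ddelta j (- r) f = g u j +i* g w j.
  have sj : (-1) ^+ j * (-1) ^+ j = 1 :> R[i] by rewrite -exprD addnn -mul2n exprM sqrrN expr1n expr1n.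
  rewrite /ddelta mulrA sj mul1r.
  rewrite (_ : (-1) ^+ j = ((-1) ^+ j)%:C :> R[i]); last by rewrite rmorphXn rmorphN1.
  by rewrite /g; simpc.
clear sr dr'; rewrite /radial_preimage -/r -/w.
pose c j := beta_coef R j m.+1.*2.+1 * r ^+ j.
transitivity ((\sum_(j < m.+1) c j * g w j) +i* (\sum_(j < m.+1) c j * g (fun r => - u r) j)).
  by rewrite /c -(prof w si) -(prof _ sr'); simpc.
rewrite mulr_sumr [RHS](eq_bigr (fun j : 'I_m.+1 => (c j * g w j) +i* (c j * g (fun r => - u r) j))).
  by elim/big_rec3: _ => // j x y z _ <-; simpc.
move=> j _; rewrite dd gN /c; move: (g u j) (g w j) => x y.
by apply/eqP; rewrite eq_complex /=; apply/andP; split; apply/eqP; ring.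
Qed.

End RadialInversion.

Theorem theorem2p3 (R : realType) (k : nat) (hk : (3 <= k)%N) (hodd : odd k)
    (Lambda S : set 'rV[R]_k) (a b : 'rV[R]_k -> R[i])
    (hLambda : locally_finite_set Lambda)
    (hsupp : dsupport (atomic Lambda a) = Lambda)
    (hmu : temperate (atomic Lambda a))
    (hS : locally_finite_set S)
    (hmuhat : has_fourier_transform (@fourier R k)
                (atomic Lambda a) (atomic S b))
    (hLambda0 : ~ Lambda 0) (hS0 : ~ S 0) :
  let sigma : (R -> R[i]) -> R[i] := fun phi =>
    \sum_(l \in Lambda) a l / (enorm l)%:C *
      (delta (enorm l) phi - delta (- enorm l) phi) in
  temperate sigma /\
  has_fourier_transform (@fourier1 R) sigma (fun phi =>
    - 'i%C * \sum_(s \in S) b s / (enorm s ^+ (k - 2)%N)%:C *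
      (\sum_(0 <= j < ((k - 3)./2).+1%N)
         (beta_coef R j k)%:C * (enorm s ^+ j)%:C *
         ((-1) ^+ j * ddelta j (enorm s) phi - ddelta j (- enorm s) phi))).
Proof.
move=> sigma.
have [m km] : exists m, k = m.+1.*2.+1.
  exists (k - 3)./2; have := odd_double_half (k - 3).
  by rewrite oddB// hodd /= add0n; lia.
subst k; clear hk hodd hLambda hsupp hmu hS.
have nz (x : 'rV[R]_(m.+1.*2.+1)) n : x != 0 -> (enorm x ^+ n)%:C != 0 :> R[i].
  by move=> x0; rewrite eq_complex /= eqxx andbT expf_neq0// enorm_eq0.
have [T [contT TE] TF] := hmuhat.
have contT' := radial_pullback_continuous contT.
(* [0] is not in [Lambda], so the value of [quot] at the origin never occurs *)
have sigmaE : eq_distribution (fun f => T (radial_quotient f)) sigma.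
  move=> f tf; rewrite TE; last exact: test_function_radial_quotient.
  apply: eq_fsbigr => l /[!inE] Ll.
  have l0 : l != 0 by apply: contra_notN hLambda0 => /eqP <-.
  rewrite -mulrA; congr (_ * _); rewrite /delta /radial_quotient /quot enorm_eq0 (negbTE l0).
  have := nz l 1%N l0; rewrite expr1 => /mulKf nl; apply: (can_inj nl).
  rewrite mulVKf; last by have := nz l 1%N l0.
  apply/eqP; rewrite eq_complex /oddp /=.
  move: (f (enorm l)) (f (- enorm l)) => [x y] [x' y'] /=.
  by rewrite !mul0r subr0 addr0 ![enorm l * _]mulrC !mulfVK ?enorm_eq0// !eqxx.
have extT : schwartz_extension sigma (fun f => T (radial_quotient f)) by [].
split; first by split; [exact: schwartz_extension_distribution extT|exists (fun f => T (radial_quotient f))].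
exists (fun f => T (radial_quotient f)) => // f tf.
rewrite radial_quotient_fourier1// TF; last exact: test_function_radial_preimage.
(* The values of the two functionals agree term by term over [S] *)
rewrite mulr_fsumr; apply: eq_fsbigr => s /[!inE] Ss.
have s0 : s != 0 by apply: contra_notN hS0 => /eqP <-.
have e2 : (m.+1.*2.+1 - 2 = 2 * m + 1)%N by lia.
have e3 : ((m.+1.*2.+1 - 3)./2 = m)%N by rewrite -[RHS]doubleK; congr _./2; lia.
rewrite e2 e3 big_mkord mulrCA -radial_preimageE; last exact: tf.1.
by rewrite [X in _ = _ * X]mulrC mulrA divfK// nz.
Qed.
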